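(* Let $\nu>-1+(r-1)a/2$. For each $\alpha\in\left(\frac{p-\nu-2}{2},\frac{\nu+b+2}{2}\right)$, the set $\mathcal{W}^\alpha_{loc}(\mathcal{A}^2_\nu)$ is a self-adjoint subalgebra of $\mathcal{L}(\mathcal{A}^2_\nu)$ (i.e. a linear subspace closed under products and adjoints).
   Context: Domain. $\Omega\subset\mathbb{C}^n$ is an irreducible bounded symmetric domain in its Harish-Chandra realization (so it is convex, circled and contains $0$), of type $(r,a,b)$: $r$ is the rank and $a,b$ are the multiplicities, i.e. in the restricted root system, with $\gamma_1,\dots,\gamma_r$ the restrictions of the Harish-Chandra strongly orthogonal roots, the roots $\pm\gamma_j$ have multiplicity $1$, $\frac12(\pm\gamma_i\pm\gamma_j)$ ($i\ne j$) have multiplicity $a$, and $\pm\frac12\gamma_j$ have multiplicity $2b$. The genus is $p=(r-1)a+b+2$. $dz$ is Lebesgue measure on $\Omega$ normalized to total mass $1$. The Jordan triple determinant $h(z,w)$ is the polynomial in $\bar z$ and $w$, nonvanishing on $\Omega\times\Omega$, with $h(z,0)=1$, such that $h(z,w)^{-p}$ is the reproducing kernel $K(w,z)$ of the space of holomorphic functions in $L^2(\Omega,dz)$; $h(z,z)>0$, and real powers of $h$ on $\Omega\times\Omega$ use the continuous branch equal to $1$ at $w=0$. $G$ is the identity component of the group of biholomorphic automorphisms of $\Omega$, acting by $z\mapsto x\cdot z$; for $x,y\in G$ write $h(x,y):=h(x\cdot0,y\cdot0)$. $d\lambda(z)=h(z,z)^{-p}dz$ is $G$-invariant, and $\mu_G$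 is the Haar measure on $G$ (unimodular) normalized so that $\int_G f(x\cdot0)\,d\mu_G(x)=\int_\Omega f\,d\lambda$. Bergman space. For $\nu>-1$, $dv_\nu(z)=c_\nu h(z,z)^\nu dz$ with $c_\nu>0$ such that $v_\nu(\Omega)=1$. $\mathcal{A}^2_\nu=\mathcal{A}^2_\nu(\Omega)$ is the Hilbert space of holomorphic functions in $L^2(\Omega,dv_\nu)$, with inner product $\langle\cdot,\cdot\rangle_\nu$, reproducing kernel $K^\nu_z(w)=h(z,w)^{-(\nu+p)}$ and normalized kernels $k^\nu_z=K^\nu_z/\|K^\nu_z\|_\nu$. $\mathcal{L}(\mathcal{A}^2_\nu)$ is the algebra of bounded operators on $\mathcal{A}^2_\nu$. For $x\in G$ the unitary operator $\pi_\nu(x)$ is $(\pi_\nu(x)f)(w)=k^\nu_{x\cdot0}(w)f(x^{-1}\cdot w)$; $\pi_\nu$ is an irreducible projective unitary representation of $G$. $1$ denotes the constant function. Weakly localized operators. Let $\beta$ be the Bergman distance on $\Omega$, i.e. the distance induced by the Hermitian metric $g_{i,j}(z)=\partial_i\bar\partial_j\log K(z,z)$ (length of a tangent vector $\xi$ at $z$: $(\sum_{i,j}g_{i,j}(z)\xi_i\bar\xi_j)^{1/2}$). For $x\in G$, $\rho\ge0$ put $G_\rho(x)=\{y\in G:\beta(x\cdot0,y\cdot0)<\rho\}$. For $S\in\mathcal{L}(\mathcal{A}^2_\nu)$, $$I^\alpha_S(\rho)=\sup_{x\in G}\int_{G\setminus G_\rho(x)}|\langle S\pi_\nu(x)1,\pi_\nu(y)1\rangle_\nu|\frac{h(y,y)^\alpha}{h(x,x)^\alpha}\,d\mu_G(y).$$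 $\mathcal{W}^\alpha_{loc}(\mathcal{A}^2_\nu)$ is the set of all $S\in\mathcal{L}(\mathcal{A}^2_\nu)$ with $I^\alpha_S(0)<\infty$, $I^\alpha_{S^*}(0)<\infty$, $\lim_{\rho\to\infty}I^\alpha_S(\rho)=0$ and $\lim_{\rho\to\infty}I^\alpha_{S^*}(\rho)=0$. *)

(* Defs.v *)
From HB Require Import structures.
From mathcomp Require Import all_boot all_order all_algebra.
From mathcomp Require Import complex.
From mathcomp Require Import all_classical all_reals all_analysis measurable_realfun.

Set Implicit Arguments.
Unset Strict Implicit.
Unset Printing Implicit Defensive.

Import Order.TTheory GRing.Theory Num.Theory.
Import numFieldNormedType.Exports.

Local Open Scope classical_set_scope.
Local Open Scope ring_scope.
Local Open Scope complex_scope.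

(* The norm topology on [R[i]]; with it, [differentiable] between normed modules
   over [R[i]] is Frechet differentiability over the complex field. *)
HB.instance Definition _ (R : realType) := NormedModule.copy R[i] R[i]^o.

Section Domains.
Variable R : realType.
Local Notation C := R[i].

Definition zero_ext (V : Type) (W : zmodType) (D : set V) (f : V -> W) : V -> W :=
  fun z => if z \in D then f z else 0.

Definition holomorphic_on (V W : normedModType C) (D : set V) (f : V -> W) :=
  forall z, D z -> differentiable f z.

Definition domain (V : normedModType C) (D : set V) :=
  [/\ open D, connected D & D !=set0].

Definition biholomorphic (V W : normedModType C) (D : set V) (E : set W) :=
  exists (f : V -> W) (g : W -> V),
    [/\ holomorphic_on D f, holomorphic_on E g,
        forall z, D z -> E (f z) /\ g (f z) = z
      & forall w, E w -> D (g w) /\ f (g w) = w].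

(* An automorphism of [D] is represented by its unique extension to the ambient
   space by the identity outside [D], so that the group law is composition. *)
Definition Aut (V : normedModType C) (D : set V) : set (V -> V) :=
  [set x | (forall z, ~ D z -> x z = z) /\
     exists y : V -> V,
       [/\ cancel x y, cancel y x,
           forall z, D z -> D (x z) /\ D (y z),
           holomorphic_on D x & holomorphic_on D y]].

Definition bounded_symmetric_domain (V : normedModType C) (D : set V) :=
  [/\ domain D, bounded_set D
    & forall z, D z -> exists s,
        [/\ Aut D s, s \o s = id, s z = z
          & \forall w \near z, s w = w -> w = z]].

Definition irreducible_domain (n : nat) (D : set 'rV[C]_n.+1) :=
  ~ exists (k l : nat) (D1 : set 'rV[C]_k.+1) (D2 : set 'rV[C]_l.+1),
      [/\ bounded_symmetric_domain D1, bounded_symmetric_domain D2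
        & biholomorphic D (D1 `*` D2)].

(* A bounded symmetric domain containing 0 and circled about 0 is a
   Harish-Chandra realization, unique up to a linear change of coordinates. *)
Definition harish_chandra (n : nat) (D : set 'rV[C]_n.+1) :=
  [/\ D 0,
      forall (c : C) z, `|c| = 1 -> D z -> D (c *: z)
    & forall (t : R) z w, 0 <= t <= 1 -> D z -> D w ->
        D (t%:C *: z + (1 - t)%:C *: w)].

End Domains.

Section RestrictedRoots.
Variables (R : realType) (n : nat).
Local Notation C := R[i].
Local Notation T := 'rV[C]_n.+1.
Variable Omega : set T.

Definition has_velocity (c : R -> T) (t : R) (v : T) :=
  forall i, is_derive t (1 : R) (fun s => complex.Re (c s 0 i)) (complex.Re (v 0 i)) /\
            is_derive t (1 : R) (fun s => complex.Im (c s 0 i)) (complex.Im (v 0 i)).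

(* The Lie algebra of the automorphism group: the complete holomorphic vector
   fields on Omega, extended by 0. *)
Definition lie_g : set (T -> T) :=
  [set X | [/\ forall z, ~ Omega z -> X z = 0,
               holomorphic_on Omega X
             & exists phi : R -> T -> T,
                 [/\ forall t, Aut Omega (phi t),
                     forall s t, phi (s + t) = phi s \o phi t
                   & forall t z, Omega z ->
                       has_velocity (fun s => phi s z) t (X (phi t z))]]].

Definition bracket (X Y : T -> T) : T -> T :=
  zero_ext Omega (fun z => 'd X z (Y z) - 'd Y z (X z)).

(* The (-1)-eigenspace of the Cartan involution X |-> s_* X, where s = - id is
   the symmetry of Omega at 0. *)
Definition lie_p : set (T -> T) :=
  [set X | lie_g X /\ forall z, X (- z) = X z].

Definition rcomb (d : nat) (c : 'I_d -> R) (e : 'I_d -> T -> T) : T -> T :=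
  fun z => \sum_i (c i)%:C *: e i z.

Definition rfree (d : nat) (e : 'I_d -> T -> T) :=
  forall c, rcomb c e = (fun=> 0) -> forall i, c i = 0.

Definition has_rdim (V : set (T -> T)) (d : nat) :=
  exists e : 'I_d -> T -> T,
    [/\ forall i, V (e i), rfree e
      & forall X, V X -> exists c, X = rcomb c e].

(* [H] is a basis of a maximal abelian subspace of [lie_p]. *)
Definition max_abelian_basis (r : nat) (H : 'I_r -> T -> T) :=
  [/\ forall j, lie_p (H j),
      rfree H,
      forall i j, bracket (H i) (H j) = (fun=> 0)
    & forall X, lie_p X -> (forall j, bracket (H j) X = (fun=> 0)) ->
        exists c, X = rcomb c H].

(* A linear form on the span of [H] is given by its values on [H]. *)
Definition root_space (r : nat) (H : 'I_r -> T -> T) (lam : 'rV[R]_r) :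
    set (T -> T) :=
  [set X | lie_g X /\
     forall j, bracket (H j) X = (fun z => (lam 0 j)%:C *: X z)].

(* The basis [H] is normalized by gamma_j(H_k) = 2 delta_jk. *)
Definition gamma (r : nat) (j : 'I_r) : 'rV[R]_r := 2 *: delta_mx 0 j.

Definition root_gamma (r : nat) (s : bool) (j : 'I_r) : 'rV[R]_r :=
  (-1) ^+ s *: gamma j.

Definition root_mixed (r : nat) (s t : bool) (i j : 'I_r) : 'rV[R]_r :=
  2^-1 *: (root_gamma s i + root_gamma t j).

Definition root_half (r : nat) (s : bool) (j : 'I_r) : 'rV[R]_r :=
  2^-1 *: root_gamma s j.

Definition of_type (r a b : nat) :=
  exists H : 'I_r -> T -> T,
    [/\ max_abelian_basis H,
        forall s j, has_rdim (root_space H (root_gamma s j)) 1,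
        forall s t i j, i != j ->
          has_rdim (root_space H (root_mixed s t i j)) a,
        forall s j, has_rdim (root_space H (root_half s j)) (2 * b)
      & forall lam, lam != 0 ->
          (exists2 X, root_space H lam X & X <> (fun=> 0)) ->
          [\/ exists s j, lam = root_gamma s j,
              exists s t i j, i != j /\ lam = root_mixed s t i j
            | exists s j, lam = root_half s j]].

End RestrictedRoots.

Definition genus (r a b : nat) : nat := (r.-1 * a + b + 2)%N.

Definition cexp (R : realType) (z : R[i]) : R[i] :=
  (expR (complex.Re z))%:C * (cos (complex.Im z) +i* sin (complex.Im z)).

Notation borel T := (g_sigma_algebraType (@open T)).

Section Bergman.
Variables (R : realType) (n : nat).
Local Notation C := R[i].
Local Notation T := 'rV[C]_n.+1.

Definition box (a b : T) : set T :=
  [set z | forall i,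
     complex.Re (a 0 i) <= complex.Re (z 0 i) < complex.Re (b 0 i) /\
     complex.Im (a 0 i) <= complex.Im (z 0 i) < complex.Im (b 0 i)].

Definition is_lebesgue (mu : {measure set (borel T) -> \bar R}) :=
  forall a b : T,
    (forall i, complex.Re (a 0 i) <= complex.Re (b 0 i) /\
               complex.Im (a 0 i) <= complex.Im (b 0 i)) ->
    mu (box a b) =
    (\prod_i ((complex.Re (b 0 i) - complex.Re (a 0 i)) *
              (complex.Im (b 0 i) - complex.Im (a 0 i))))%:E.

Definition normalized_lebesgue (Omega : set T)
    (vol : {measure set (borel T) -> \bar R}) :=
  exists2 mu : {measure set (borel T) -> \bar R}, is_lebesgue mu &
    forall A, measurable A ->
      vol A = (mu (A `&` Omega) * ((fine (mu Omega))^-1)%:E)%E.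

Variables (Omega : set T) (vol : {measure set (borel T) -> \bar R}).

Definition complex_integral (F : T -> C) : C :=
  Rintegral vol Omega (fun z => complex.Re (F z)) +i*
  Rintegral vol Omega (fun z => complex.Im (F z)).

(* In what follows [wt] is a density: the measure is [wt z dz]. *)
Definition inner (wt : T -> R) (f g : T -> C) : C :=
  complex_integral (fun z => f z * (g z)^* * (wt z)%:C).

Definition norm2 (wt : T -> R) (f : T -> C) : R :=
  Num.sqrt (complex.Re (inner wt f f)).

(* A function on Omega is represented by its extension by 0. *)
Definition bergman_space (wt : T -> R) : set (T -> C) :=
  [set f | [/\ forall z, ~ Omega z -> f z = 0,
               holomorphic_on Omega f
             & (\int[vol]_(z in Omega) (Normc.normc (f z) ^+ 2 * wt z)%:E < +oo)%E]].

Definition reproducing_kernel (wt : T -> R) (K : T -> T -> C) :=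
  forall z, Omega z ->
    bergman_space wt (K z) /\
    forall f, bergman_space wt f -> f z = inner wt f (K z).

(* h(z,w) is a polynomial in conj(z) and w. *)
Definition sesqui_polynomial (h : T -> T -> C) :=
  exists (N : nat) (c : {ffun 'I_n.+1 -> 'I_N} -> {ffun 'I_n.+1 -> 'I_N} -> C),
    forall z w, h z w = \sum_a \sum_b
      c a b * (\prod_i ((z 0 i)^* ^+ a i) * \prod_i (w 0 i ^+ b i)).

Definition triple_determinant (p : nat) (h : T -> T -> C) :=
  [/\ sesqui_polynomial h,
      forall z w, Omega z -> Omega w -> h z w != 0,
      forall z, Omega z -> h z 0 = 1,
      forall z, Omega z -> 0 < h z z
    & reproducing_kernel (fun=> 1) (fun z => zero_ext Omega (fun w => h z w ^- p))].

(* h(z,z)^s for real s. *)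
Definition hpow (h : T -> T -> C) (s : R) (z : T) : R :=
  complex.Re (h z z) `^ s.

Definition log_branch (h L : T -> T -> C) :=
  [/\ {within Omega `*` Omega, continuous (fun zw : T * T => L zw.1 zw.2)},
      forall z w, Omega z -> Omega w -> cexp (L z w) = h z w
    & forall z, Omega z -> L z 0 = 0].

(* c_nu h(z,z)^nu, the density of the measure v_nu. *)
Definition bergman_weight (h : T -> T -> C) (nu : R) (z : T) : R :=
  (Rintegral vol Omega (hpow h nu))^-1 * hpow h nu z.

(* [K z] is the reproducing kernel of the weighted Bergman space at z, and
   K z w = h(z,w)^-(nu+p) for the branch of the power equal to 1 at w = 0. *)
Definition weighted_kernel (p : nat) (h : T -> T -> C) (nu : R)
    (K : T -> T -> C) :=
  reproducing_kernel (bergman_weight h nu) K /\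
  exists2 L, log_branch h L &
    forall z w, Omega z -> Omega w -> K z w = cexp (- (nu + p%:R)%:C * L z w).

Definition normalized_kernel (wt : T -> R) (K : T -> T -> C) (z w : T) : C :=
  K z w / (norm2 wt (K z))%:C.

End Bergman.

Section BergmanDistance.
Variables (R : realType) (n : nat).
Local Notation C := R[i].
Local Notation T := 'rV[C]_n.+1.
Variables (Omega : set T) (p : nat) (h : T -> T -> C).

Definition log_kernel (z : T) : R := ln (complex.Re (h z z ^- p)).

(* Derivative along the real line z + t v. *)
Definition dir_derive (v : T) (F : T -> C) (z : T) : C :=
  derive1 (fun t : R => complex.Re (F (z + t%:C *: v))) 0 +i*
  derive1 (fun t : R => complex.Im (F (z + t%:C *: v))) 0.

Definition wirtinger (i : 'I_n.+1) (F : T -> C) (z : T) : C :=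
  2^-1 * (dir_derive (delta_mx 0 i) F z
          - 'i%C * dir_derive ('i%C *: delta_mx 0 i) F z).

Definition wirtinger_bar (i : 'I_n.+1) (F : T -> C) (z : T) : C :=
  2^-1 * (dir_derive (delta_mx 0 i) F z
          + 'i%C * dir_derive ('i%C *: delta_mx 0 i) F z).

Definition bergman_metric (i j : 'I_n.+1) : T -> C :=
  wirtinger i (wirtinger_bar j (fun z => (log_kernel z)%:C)).

Definition vector_length (z xi : T) : R :=
  Num.sqrt (complex.Re
    (\sum_i \sum_j bergman_metric i j z * xi 0 i * (xi 0 j)^*)).

Definition C1_curve (c : R -> T) :=
  forall i,
    [/\ forall t, derivable (fun s : R => complex.Re (c s 0 i)) t 1,
        forall t, derivable (fun s : R => complex.Im (c s 0 i)) t 1,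
        continuous (derive1 (fun s : R => complex.Re (c s 0 i)))
      & continuous (derive1 (fun s : R => complex.Im (c s 0 i)))].

Definition velocity (c : R -> T) (t : R) : T :=
  \row_i (derive1 (fun s : R => complex.Re (c s 0 i)) t +i*
          derive1 (fun s : R => complex.Im (c s 0 i)) t).

Definition curve_length (c : R -> T) : \bar R :=
  (\int[lebesgue_measure]_(t in `[0%R, 1%R])
     (vector_length (c t) (velocity c t))%:E)%E.

(* Piecewise C1 paths in Omega from z to w, as the list of their pieces, each
   parametrized by [0, 1]. *)
Fixpoint C1_path (z : T) (s : seq (R -> T)) (w : T) : Prop :=
  if s is c :: s' then
    [/\ C1_curve c, forall t, 0 <= t <= 1 -> Omega (c t), c 0 = z
      & C1_path (c 1) s' w]
  else z = w.

Definition bergman_dist (z w : T) : \bar R :=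
  ereal_inf [set (\sum_(c <- s) curve_length c)%E
            | s in [set s | C1_path z s w]].

End BergmanDistance.

Section Group.
Variables (R : realType) (n : nat).
Local Notation C := R[i].
Local Notation T := 'rV[C]_n.+1.
Variable Omega : set T.

(* Uniform convergence on the compact subsets of Omega, which on [Aut Omega] is
   the compact-open topology. *)
Definition cofun := {family [set K : set T | compact K /\ K `<=` Omega], T -> T}.
HB.instance Definition _ := Topological.on cofun.

Definition Aut0 : set cofun :=
  @connected_component cofun (Aut Omega : set cofun) (idfun : T -> T).

Lemma Aut_id : Aut Omega idfun.
Proof. by split=> //; exists idfun; split=> // z _; exact: differentiable_id. Qed.

Lemma Aut0_id : Aut0 (idfun : T -> T).
Proof. by apply: connected_component_refl; exact: Aut_id. Qed.

Definition autG := {x : T -> T | Aut0 x}.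

Definition act (x : autG) (z : T) : T := sval x z.

HB.instance Definition _ := gen_eqMixin autG.
HB.instance Definition _ := gen_choiceMixin autG.
HB.instance Definition _ := isPointed.Build autG (exist _ _ Aut0_id).

(* The Borel sigma-algebra of the subspace topology on the group. *)
Definition openG : set (set autG) :=
  [set A | exists2 U : set cofun, open U & A = [set x | U (sval x)]].
Definition borelG := g_sigma_algebraType openG.
HB.instance Definition _ := Measurable.on borelG.

Definition left_invariant (muG : {measure set borelG -> \bar R}) :=
  forall (g : autG) (A : set borelG), measurable A ->
    muG [set x | exists2 y, A y & act x = act g \o act y] = muG A.

Variable vol : {measure set (borel T) -> \bar R}.

(* Left-invariance and the integral normalization determine [muG]; the latter
   also makes it nonzero and finite on compact sets. *)
Definition normalized_haar (p : nat) (h : T -> T -> C)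
    (muG : {measure set borelG -> \bar R}) :=
  left_invariant muG /\
  forall f : borel T -> \bar R, measurable_fun setT f ->
    (forall z, 0 <= f z)%E ->
    (\int[muG]_x f (act x 0) =
     \int[vol]_(z in Omega) (f z * (complex.Re (h z z) ^- p)%:E))%E.

(* x^-1 . w *)
Definition act_inv (x : autG) (w : T) : T := xget 0 [set z | act x z = w].

End Group.

Section WeaklyLocalized.
Variables (R : realType) (n : nat).
Local Notation C := R[i].
Local Notation T := 'rV[C]_n.+1.
Variables (Omega : set T) (vol : {measure set (borel T) -> \bar R}).
Variables (p : nat) (h : T -> T -> C) (nu : R) (K : T -> T -> C).
Variable muG : {measure set (borelG Omega) -> \bar R}.

Local Notation wt := (bergman_weight Omega vol h nu).
Local Notation A2 := (bergman_space Omega vol wt).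
Local Notation "<< f , g >>" := (inner Omega vol wt f g).
Local Notation operator := ((T -> C) -> T -> C).

(* A bounded operator is extended by 0 outside the Bergman space, so that equal
   operators are equal maps. *)
Definition bounded_operator : set operator :=
  [set S | [/\ forall f, ~ A2 f -> S f = (fun=> 0),
               forall f, A2 f -> A2 (S f),
               forall (c : C) f g, A2 f -> A2 g ->
                 S (fun z => c * f z + g z) = (fun z => c * S f z + S g z)
             & exists M : R, forall f, A2 f ->
                 norm2 Omega vol wt (S f) <= M * norm2 Omega vol wt f]].

Definition adjoint (S S' : operator) :=
  bounded_operator S' /\ forall f g, A2 f -> A2 g -> << S f, g >> = << f, S' g >>.

Definition repr_pi (x : autG Omega) (f : T -> C) : T -> C :=
  fun w => normalized_kernel Omega vol wt K (act x 0) w * f (act_inv x w).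

Definition one_fun : T -> C := zero_ext Omega (fun=> 1).

Definition Gball (rho : R) (x : autG Omega) : set (borelG Omega) :=
  [set y | (bergman_dist Omega p h (act x 0) (act y 0) < rho%:E)%E].

Definition I_loc (alpha : R) (S : operator) (rho : R) : \bar R :=
  ereal_sup [set (\int[muG]_(y in ~` Gball rho x)
      (Normc.normc << S (repr_pi x one_fun), repr_pi y one_fun >> *
       (hpow h alpha (act y 0) / hpow h alpha (act x 0)))%:E)%E
    | x in [set: autG Omega]].

Definition W_loc (alpha : R) : set operator :=
  [set S | bounded_operator S /\
     exists S', [/\ adjoint S S',
       (I_loc alpha S 0 < +oo)%E, (I_loc alpha S' 0 < +oo)%E,
       I_loc alpha S rho @[rho --> +oo] --> 0%E
     & I_loc alpha S' rho @[rho --> +oo] --> 0%E]].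

Definition self_adjoint_subalgebra (W : set operator) :=
  [/\ W `<=` bounded_operator,
      W (fun _ _ => 0),
      forall (c : C) S1 S2, W S1 -> W S2 ->
        W (fun f z => c * S1 f z + S2 f z),
      forall S1 S2, W S1 -> W S2 -> W (S1 \o S2)
    & forall S, W S -> exists2 S', adjoint S S' & W S'].

End WeaklyLocalized.

(* Main.v *)
Require Import Defs.
From HB Require Import structures.
From mathcomp Require Import all_boot all_order all_algebra.
From mathcomp Require Import complex.
From mathcomp Require Import all_classical all_reals all_analysis measurable_realfun ring lra.

Set Implicit Arguments.
Unset Strict Implicit.
Unset Printing Implicit Defensive.

Import Order.TTheory GRing.Theory Num.Theory.
Import numFieldNormedType.Exports.

Local Open Scope classical_set_scope.
Local Open Scope ring_scope.

(** With [z = x . 0] one has [pi_nu(x) 1 = k_z], so the matrix coefficients are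
    [<S k_z, k_w> = (S k_z)(w) / ||K_w||] and, by the integral normalization of
    the Haar measure, [I_S(rho)] is a supremum of integrals over [Omega] against
    [h(w,w)^-p dw].  Since [||K_u||^2 h(u,u)^nu = h(u,u)^-p], writing out the
    inner product in [<S1 S2 k_z, k_w> = <S2 k_z, S1^* k_w>] gives
    [|<S1 S2 k_z, k_w>| <= C * int |<S2 k_z, k_u>| |<S1 k_u, k_w>| h(u,u)^-p du].
    If [beta(z,w) >= s + t] then [beta(z,u) >= s] or [beta(u,w) >= t], so Tonelli
    yields [I_{S1 S2}(s + t) <= C (I_S1(0) I_S2(s) + I_S1(t) I_S2(0))].
    Measurability needs two facts: Bergman balls are open (the metric has
    rational coefficients, hence is locally bounded), and
    [(u,w) |-> <S k_u, k_w>] is separately continuous up to measurable factors,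
    hence jointly measurable. *)

(** Tonelli is carried out for [vol], which is a finite measure, and not on the group; [muG] enters
    through its integral formula, which moves functions of [y . 0] to [Omega] and back. That formula
    takes Borel functions on the whole space, so its integrands are extended by 0. The delicate
    point is the first variable of [<S k_u, k_w>]: the definition of a bounded operator says nothing
    about how [S k_u] depends on [u], but [|<S k_u, k_w>| = |(S^* k_w)(u)| / ||K_u||] is the modulus
    of a holomorphic function of [u], divided by a norm. So the adjoint supplies the regularity in
    that variable. The weight ratio telescopes through [u], which is why the estimate for products
    closes up with the same [alpha]. The constant is [C = 2 c_nu]: the 2 is the price of bounding
    real and imaginary parts separately, [c_nu] is the normalization of the weight, and only the
    finiteness of [C] matters. *)

(** * Monotonicity of integrals, Tonelli, measurability on products *)

Section Measure.
Context {d : measure_display} {T : measurableType d} {R : realType}.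
Implicit Types mu : {measure set T -> \bar R}.
Local Open Scope ereal_scope.

(** The integral of a nonnegative function is a supremum over the simple functions below it, so
    monotonicity holds for arbitrary integrands. It is applied, for one, to the length of a curve,
    whose integrand is only bounded pointwise. *)
Lemma ge0_le_integral_nomeas mu (D : set T) (f g : T -> \bar R) :
  (forall x, D x -> 0 <= f x) -> (forall x, D x -> f x <= g x) ->
  \int[mu]_(x in D) f x <= \int[mu]_(x in D) g x.
Proof.
move=> f0 fg; have g0 x : D x -> 0 <= g x by move=> Dx; exact: le_trans (f0 _ Dx) (fg _ Dx).
rewrite !ge0_integralE//; apply: ereal_sup_le => _ /= [h hf] <-.
exists h => // x; apply: (le_trans (hf x)).
rewrite !patchE; case: ifPn => // /[!inE]; exact: fg.
Qed.

(** A finite measure is sigma-finite. Since [mu] is a bare measure, the structure that Fubini's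
    theorem expects is packed around the same set function, as [m]. *)
Lemma finite_tonelli mu (f : T * T -> \bar R) : mu setT < +oo ->
  measurable_fun setT f -> (forall x, 0 <= f x) ->
  [/\ measurable_fun setT (fun x => \int[mu]_y f (x, y)),
      measurable_fun setT (fun y => \int[mu]_x f (x, y))
    & \int[mu]_x \int[mu]_y f (x, y) = \int[mu]_y \int[mu]_x f (x, y)].
Proof.
move=> /lty_fin_num_fun mufin mf f0.
have musf : sigma_finite setT mu.
  by apply: fin_num_fun_sigma_finite mufin; rewrite measure0.
have H1 := @isSFinite.Build _ _ _ (Measure.sort mu) (sfinite_measure_sigma_finite musf).
have H2 := @isSigmaFinite.Build _ _ _ (Measure.sort mu) musf.
pose m := HB.pack_for (SigmaFiniteMeasure.type T R) (Measure.sort mu) H1 H2.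
have mE g : \int[mu]_x g x = \int[m]_x g x by apply: eq_measure_integral.
split.
- rewrite (_ : (fun x => _) = fubini_F m f); last by apply/funext => x; exact: mE.
  exact: measurable_fun_fubini_tonelli_F.
- rewrite (_ : (fun y => _) = fubini_G m f); last by apply/funext => y; exact: mE.
  exact: measurable_fun_fubini_tonelli_G.
rewrite !mE (eq_integral (fun x => \int[m]_y f (x, y)))//.
rewrite (@fubini_tonelli _ _ _ _ _ m m)//.
Qed.
End Measure.

Lemma measurable_funX_fst d1 d2 d3 (T1 : measurableType d1) (T2 : measurableType d2)
    (T3 : measurableType d3) (D : set T1) (E : set T2) (f : T1 -> T3) :
  measurable D -> measurable_fun D f -> measurable_fun (D `*` E) (fun x => f x.1).
Proof.
move=> mD mf; apply: (@measurable_comp _ _ _ _ _ _ D f (D `*` E) fst) => //.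
  by move=> _ [[u w] [/= Du _] <-].
by apply: measurable_funTS; exact: measurable_fst.
Qed.

Lemma measurable_funX_snd d1 d2 d3 (T1 : measurableType d1) (T2 : measurableType d2)
    (T3 : measurableType d3) (D : set T1) (E : set T2) (f : T2 -> T3) :
  measurable E -> measurable_fun E f -> measurable_fun (D `*` E) (fun x => f x.2).
Proof.
move=> mE mf; apply: (@measurable_comp _ _ _ _ _ _ E f (D `*` E) snd) => //.
  by move=> _ [[u w] [/= _ Ew] <-].
by apply: measurable_funTS; exact: measurable_snd.
Qed.

(** * Borel sets and continuous functions *)

Section Borel.
Context {V : ptopologicalType} {R : realType}.
Implicit Types (D : set V) (f : V -> R).

Lemma open_borel D : open D -> measurable (D : set (borel V)).
Proof. by move=> oD; exact: sub_sigma_algebra. Qed.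

Lemma continuous_in_measurable D f : open D ->
  (forall z, D z -> {for z, continuous f}) ->
  measurable_fun (D : set (borel V)) f.
Proof.
move=> oD cf mD; apply: (measurability _ (RGenOInfty.measurableE R)) => //.
move=> _ [_ [x ->] <-]; apply: open_borel.
rewrite openE => z [Dz /= fz]; near=> t; split; near: t.
  exact: open_nbhs_nbhs.
by apply: (cf z Dz); apply: open_nbhs_nbhs; split => //; exact: interval_open.
Unshelve. all: by end_near. Qed.
End Borel.

(** * The real-valued norm of complex numbers *)

Section ComplexNorm.
Context {R : realType}.
Implicit Types z : R[i].
Local Open Scope complex_scope.

Lemma normCE z : `|z| = (Normc.normc z)%:C.
Proof. by []. Qed.

Lemma normc_ge0 z : 0 <= Normc.normc z.
Proof. by rewrite -ler0c -normCE normr_ge0. Qed.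

Lemma normr_Re_le z : `|complex.Re z| <= Normc.normc z.
Proof. by rewrite -lecR -normCE; exact: normc_ge_Re. Qed.

Lemma normr_Im_le z : `|complex.Im z| <= Normc.normc z.
Proof.
by case: z => x y /=; rewrite -sqrtr_sqr ler_wsqrtr// lerDr sqr_ge0.
Qed.

Lemma normc_le_ReIm z : Normc.normc z <= `|complex.Re z| + `|complex.Im z|.
Proof.
rewrite -[z in leLHS](_ : (complex.Re z +i* 0) + (0 +i* complex.Im z) = z).
  apply: (le_trans (le_normcD _ _)).
  by rewrite /Normc.normc expr0n /= addr0 add0r !sqrtr_sqr.
by case: z => x y; apply/eqP; rewrite eq_complex /= addr0 add0r !eqxx.
Qed.

Lemma normc_real (x : R) : Normc.normc x%:C = `|x|.
Proof. by rewrite /= expr0n /= addr0 sqrtr_sqr. Qed.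

(** The norm of ['rV[C]] takes its values in [C], so radii of balls are positive complex numbers;
    such a number is real. *)
Lemma gt0_complexE z : 0 < z -> exists2 x : R, 0 < x & z = x%:C.
Proof.
move=> z0; have zE : z = (complex.Re z)%:C by rewrite RRe_real// gtr0_real.
by exists (complex.Re z) => //; rewrite -ltcR -zE.
Qed.

Lemma normc_conj z : Normc.normc z^* = Normc.normc z.
Proof. by case: z => x y /=; rewrite sqrrN. Qed.

End ComplexNorm.

(** * Rational points and a countable base *)

Section RowVectors.
Context {R : realType} {n : nat}.
Local Notation C := R[i].
Local Notation T := 'rV[C]_n.+1.
Local Open Scope complex_scope.

Definition rat_row (q : 'rV[(rat * rat)%type]_n.+1) : T :=
  \row_i (ratr (q 0 i).1 +i* ratr (q 0 i).2).

Lemma rat_row_near (z : T) (e : R) : 0 < e -> exists q, ball z e%:C (rat_row q).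
Proof.
move=> e0.
have appr (x : R) : exists q : rat, `|x - ratr q| < e / 2.
  have /rat_in_itvoo[q /itvP qx] : x < x + e / 2 by rewrite ltrDl divr_gt0.
  exists q; rewrite ltr_norml; apply/andP; split.
    by rewrite ltrBrDl -ltrBrDr opprK qx.
  by rewrite ltrBlDl (lt_le_trans _ (_ : ratr q <= _)) ?qx// ?lerDl ?divr_ge0 ?ltW.
have [qr qrP] := choice (fun i => appr (complex.Re (z 0 i))).
have [qi qiP] := choice (fun i => appr (complex.Im (z 0 i))).
exists (\row_i (qr i, qi i)); split; first by rewrite ltcR.
move=> i j; rewrite ord1 /rat_row !mxE /= -ball_normE /=.
case: (z 0 j) (qrP j) (qiP j) => x y /= hx hy.
rewrite normCE ltcR (le_lt_trans (normc_le_ReIm _))//=.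
by rewrite [e]splitr ltrD.
Qed.

Lemma rat_row_open (U : set T) : open U -> U !=set0 -> exists q, U (rat_row q).
Proof.
rewrite openE => oU [z Uz]; have /nbhs_ballP[e /= e0 zeU] := oU _ Uz.
have [e1 e10 ee] := gt0_complexE e0.
move: zeU; rewrite ee => zeU.
by have [q /zeU] := rat_row_near z e10; exists q.
Qed.

(** The index type is countable, so that unions over this base preserve measurability. *)
Definition rat_ball (i : 'rV[(rat * rat)%type]_n.+1 * nat) : set T :=
  ball (rat_row i.1) (i.2.+1%:R^-1)%:C.

Lemma rat_ball_base (z : T) (U : set T) : nbhs z U ->
  exists i, rat_ball i z /\ rat_ball i `<=` U.
Proof.
move=> /nbhs_ballP[e /= e0 zeU].
have [e1 e10 ee] := gt0_complexE e0.
move: zeU; rewrite ee => zeU.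
(* A radius below [e / 2], with the centre within that radius of [z]: the ball contains [z] and
   stays within [e] of it. *)
have [k ke] : exists k : nat, k.+1%:R^-1 < e1 / 2.
  have [k _ hk] := @near_infty_natSinv_lt R (PosNum (divr_gt0 e10 (ltr0Sn R 1))).
  by exists k; apply: (hk k); rewrite /= leqnn.
have k0 : 0 < k.+1%:R^-1 :> R by rewrite invr_gt0.
have [q zq] := rat_row_near z k0.
exists (q, k); split; first exact: ball_sym.
move=> t /= qt; apply: zeU.
rewrite [e1]splitr rmorphD /=; apply: ball_triangle (le_ball _ zq) (le_ball _ qt).
  by rewrite lecR ltW.
by rewrite lecR ltW.
Qed.

End RowVectors.

(** * Joint measurability of Caratheodory functions *)

Section Caratheodory.
Context {R : realType} {n : nat}.
Local Notation T := 'rV[R[i]]_n.+1.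
Variables (D : set T) (f : T -> T -> R).
Hypothesis oD : open D.
Hypothesis f_cont : forall w, D w -> forall z, D z -> {for z, continuous (f^~ w)}.
Hypothesis f_meas : forall z, D z -> measurable_fun (D : set (borel T)) (f z).

(* [f z w > a] iff some rational [s > a] and some basic ball [B] around [z]
   satisfy [f q w >= s] for all rational points [q] of [B]. *)
Lemma caratheodory_measurable :
  measurable_fun (D `*` D : set (borel T * borel T)) (fun x => f x.1 x.2).
Proof.
have mD := open_borel oD.
move=> mDD; apply: (measurability _ (RGenOInfty.measurableE R)) => //.
move=> _ [_ [a ->] <-]; rewrite preimage_itvoy.
(* [bad (s, B) q] collects the [w] for which [q] refutes [f q w >= s]. It is empty unless [q] lies
   in [D] and in the ball, since only such points count. Indices with [s <= a] are discarded by
   making [A] empty. *)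
pose bad (k : rat * ('rV[(rat * rat)%type]_n.+1 * nat)) q : set (borel T) :=
  if `[< (D `&` rat_ball k.2) (rat_row q) >]
  then D `&` f (rat_row q) @^-1` [set` `]-oo, ratr k.1[] else set0.
pose A (k : rat * ('rV[(rat * rat)%type]_n.+1 * nat)) : set (borel T * borel T) :=
  if a < ratr k.1 then
    (D `&` (rat_ball k.2 : set (borel T))) `*` (D `\` \bigcup_q bad k q)
  else set0.
rewrite [X in measurable X](_ : _ = \bigcup_k A k).
  apply: countable_bigcupT_measurable; first exact: countableP.
  move=> [s k]; rewrite /A /=; case: ifPn => // _.
  apply: measurableX.
    by apply: measurableI => //; apply: open_borel; exact: ball_open.
  apply: measurableD => //.
  apply: countable_bigcupT_measurable; first exact: countableP.
  move=> q; rewrite /bad; case: asboolP => //= -[Dq _].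
  exact: f_meas.
apply/seteqP; split=> [[u w] [[/= Du Dw] fa]|[u w] [[s k] _]]; last first.
  rewrite /A /=; case: ifPn => // asr [[/= Du ku] [Dw nbad]]; split => //=.
  apply: (lt_le_trans asr); rewrite leNgt; apply/negP => fs.
  (* If [f u w < s], continuity in the first variable gives the same inequality on an open set
     around [u]; a rational point of that set inside the ball then makes [w] bad. *)
  have : nbhs u (D `&` rat_ball k `&` [set z | f z w < ratr s]).
    apply: filterI; first apply: filterI.
    - exact: open_nbhs_nbhs.
    - by apply: open_nbhs_nbhs; split => //; exact: ball_open.
    - have /(_ [set x | x < ratr s]) := f_cont Dw Du; apply.
      by apply: open_nbhs_nbhs; split => //; exact: open_lt.
  rewrite nbhsE => -[U [oU Uu] UD].
  have [q Uq] := rat_row_open oU (ex_intro _ u Uu).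
  have [[Dq kq] fq] := UD _ Uq.
  apply: nbad; exists q => //; rewrite /bad; case: asboolP => [_|[]//].
  by split => //=; rewrite in_itv.
have [s /itvP as_] := rat_in_itvoo fa.
have : nbhs u (D `&` [set z | ratr s < f z w]).
  apply: filterI; first exact: open_nbhs_nbhs.
  have /(_ [set x | ratr s < x]) := f_cont Dw Du; apply.
  by apply: open_nbhs_nbhs; split; [exact: open_gt|rewrite /= as_].
move=> /rat_ball_base[k [ku kD]].
exists (s, k) => //; rewrite /A /= as_; split; split => //=.
move=> [q _]; rewrite /bad; case: asboolP => // -[Dq /kD[_ /= qs]] [_] /=.
by rewrite in_itv /= ltNge (ltW qs).
Qed.

End Caratheodory.

Local Open Scope complex_scope.

(** * Rational functions and their derivatives along real lines *)

Lemma is_derive_affine (R : realType) (a b t : R) : is_derive t 1 (fun s : R => a + s * b) b.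
Proof.
have := @is_deriveD R R R (cst a) (id * cst b) t 1 _ _ (is_derive_cst _ _ _)
  (is_deriveM (is_derive_id _ _) (is_derive_cst b _ _)).
by move=> /is_derive_eq; apply; rewrite scaler0 !add0r; exact: mulr1.
Qed.

Section RationalFunctions.
Context {R : realType} {n : nat}.
Local Notation C := R[i].
Local Notation T := 'rV[C]_n.+1.
Variable Omega : set T.
Implicit Types (f : T -> R) (F : T -> C).

Lemma Re_continuous : continuous (@complex.Re R : C -> R).
Proof.
move=> z; have F : Filter (nbhs z) by exact: nbhs_filter.
apply/cvgrPdist_lt => e e0.
apply/nbhs_ballP; exists e%:C => /=; first by rewrite ltcR.
move=> t; rewrite /= normCE ltcR; apply: le_lt_trans.
by rewrite -raddfB; exact: normr_Re_le.
Qed.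

Lemma Im_continuous : continuous (@complex.Im R : C -> R).
Proof.
move=> z; have F : Filter (nbhs z) by exact: nbhs_filter.
apply/cvgrPdist_lt => e e0.
apply/nbhs_ballP; exists e%:C => /=; first by rewrite ltcR.
move=> t; rewrite /= normCE ltcR; apply: le_lt_trans.
by rewrite -raddfB; exact: normr_Im_le.
Qed.

Lemma normc_continuous : continuous (@Normc.normc R : C -> R).
Proof.
move=> z; have F : Filter (nbhs z) by exact: nbhs_filter.
apply/cvgrPdist_lt => e e0.
apply/nbhs_ballP; exists e%:C => /=; first by rewrite ltcR.
move=> t; rewrite /= normCE ltcR; apply: le_lt_trans.
have le (x y : C) : Normc.normc x - Normc.normc y <= Normc.normc (x - y).
  by rewrite lerBlDr -[x in leLHS](subrK y) le_normcD.
rewrite ler_norml le andbT lerNl opprB (le_trans (le _ _))//.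
by rewrite -normcN opprB.
Qed.

(** Real rational functions of the real coordinates, without poles on [Omega]. They are given by
    constructors so that continuity and closure under differentiation follow by induction. *)
Inductive ratfun : (T -> R) -> Prop :=
| Ratfun_cst c : ratfun (fun=> c)
| Ratfun_Re i : ratfun (fun z => complex.Re (z 0 i))
| Ratfun_Im i : ratfun (fun z => complex.Im (z 0 i))
| Ratfun_add f g : ratfun f -> ratfun g -> ratfun (fun z => f z + g z)
| Ratfun_mul f g : ratfun f -> ratfun g -> ratfun (fun z => f z * g z)
| Ratfun_inv f : (forall z, Omega z -> f z != 0) -> ratfun f ->
    ratfun (fun z => (f z)^-1).

Lemma ratfun_opp f : ratfun f -> ratfun (fun z => - f z).
Proof.
move=> rf; rewrite (_ : (fun _ => _) = fun z => -1 * f z); last first.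
  by apply/funext => z; rewrite mulN1r.
by apply: Ratfun_mul => //; exact: Ratfun_cst.
Qed.

Lemma ratfun_exp f k : ratfun f -> ratfun (fun z => f z ^+ k).
Proof.
move=> rf; elim: k => [|k ih]; first exact: Ratfun_cst.
by under eq_fun do rewrite exprS; exact: Ratfun_mul.
Qed.

Lemma ratfun_continuous f : ratfun f ->
  forall z, Omega z -> {for z, continuous f}.
Proof.
elim=> {f} [c|i|i|f g _ cf _ cg|f g _ cf _ cg|f f0 _ cf] z Oz.
- exact: cst_continuous.
- by apply: continuous_comp; [exact: coord_continuous|exact: Re_continuous].
- by apply: continuous_comp; [exact: coord_continuous|exact: Im_continuous].
- by apply: continuousD; [exact: cf|exact: cg].
- by apply: continuousM; [exact: cf|exact: cg].
- by apply: continuousV; [exact: f0|exact: cf].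
Qed.

Lemma ratfun_derive f (v : T) : ratfun f -> exists2 g, ratfun g &
  forall z, Omega z ->
    is_derive (0 : R) 1 (fun t : R => f (z + t%:C *: v)) (g z).
Proof.
elim=> {f} [c|i|i|f f' _ [g rg fg] _ [g' rg' fg']|f f' rf [g rg fg] rf' [g' rg' fg']|f f0 rf [g rg fg]].
- exists (fun=> 0); first exact: Ratfun_cst.
  by move=> z _; exact: is_derive_cst.
- exists (fun=> complex.Re (v 0 i)); first exact: Ratfun_cst.
  move=> z _; rewrite (_ : (fun _ => _) =
    (fun t : R => complex.Re (z 0 i) + t * complex.Re (v 0 i))); first exact: is_derive_affine.
  apply/funext => t; rewrite !mxE; case: (z 0 i) (v 0 i) => a b [c d] /=.
  by rewrite mul0r subr0.
- exists (fun=> complex.Im (v 0 i)); first exact: Ratfun_cst.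
  move=> z _; rewrite (_ : (fun _ => _) =
    (fun t : R => complex.Im (z 0 i) + t * complex.Im (v 0 i))); first exact: is_derive_affine.
  apply/funext => t; rewrite !mxE; case: (z 0 i) (v 0 i) => a b [c d] /=.
  by rewrite mul0r addr0.
- exists (fun z => g z + g' z); first exact: Ratfun_add.
  by move=> z Oz; apply: is_deriveD; [exact: fg|exact: fg'].
- exists (fun z => f z * g' z + f' z * g z).
    by apply: Ratfun_add; apply: Ratfun_mul.
  move=> z Oz; apply: is_derive_eq.
    by apply: is_deriveM; [exact: fg|exact: fg'].
  by rewrite /= scale0r addr0.
- exists (fun z => - ((f z)^-1 ^+ 2) * g z).
    apply: Ratfun_mul => //; apply: ratfun_opp; apply: ratfun_exp.
    exact: Ratfun_inv.
  move=> z Oz; apply: is_derive_eq.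
    apply: is_deriveV; last exact: fg.
    by rewrite scale0r addr0; exact: f0.
  by rewrite /= scale0r addr0 exprVn.
Qed.

(** Agreement is asked on [Omega] only: elsewhere [h z z] may fail to be positive and [dir_derive]
    may be a default value. *)
Definition cratfun F := exists a b, [/\ ratfun a, ratfun b &
  forall z, Omega z -> F z = a z +i* b z].

Lemma cratfun_add F G : cratfun F -> cratfun G -> cratfun (fun z => F z + G z).
Proof.
move=> [a [b [ra rb FE]]] [a' [b' [ra' rb' GE]]].
exists (fun z => a z + a' z), (fun z => b z + b' z).
split; [exact: Ratfun_add..|].
by move=> z Oz; rewrite FE// GE.
Qed.

Lemma cratfun_mul F G : cratfun F -> cratfun G -> cratfun (fun z => F z * G z).
Proof.
move=> [a [b [ra rb FE]]] [a' [b' [ra' rb' GE]]].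
exists (fun z => a z * a' z + - (b z * b' z)), (fun z => a z * b' z + b z * a' z).
split.
- by apply: Ratfun_add; [|apply: ratfun_opp]; exact: Ratfun_mul.
- by apply: Ratfun_add; exact: Ratfun_mul.
- by move=> z Oz; rewrite FE// GE.
Qed.

Lemma cratfun_cst c : cratfun (fun=> c).
Proof.
exists (fun=> complex.Re c), (fun=> complex.Im c).
by split; [exact: Ratfun_cst..|case: c].
Qed.

Lemma cratfun_sum (I : Type) (s : seq I) (F : I -> T -> C) :
  (forall i, cratfun (F i)) -> cratfun (fun z => \sum_(i <- s) F i z).
Proof.
move=> rF; elim: s => [|i s ih].
  by under eq_fun do rewrite big_nil; exact: cratfun_cst.
by under eq_fun do rewrite big_cons; exact: cratfun_add.
Qed.

Lemma cratfun_prod (I : Type) (s : seq I) (F : I -> T -> C) :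
  (forall i, cratfun (F i)) -> cratfun (fun z => \prod_(i <- s) F i z).
Proof.
move=> rF; elim: s => [|i s ih].
  by under eq_fun do rewrite big_nil; exact: cratfun_cst.
by under eq_fun do rewrite big_cons; exact: cratfun_mul.
Qed.

Lemma cratfun_exp F k : cratfun F -> cratfun (fun z => F z ^+ k).
Proof.
move=> rf; elim: k => [|k ih]; first exact: cratfun_cst.
by under eq_fun do rewrite exprS; exact: cratfun_mul.
Qed.

Lemma cratfun_coord i : cratfun (fun z => z 0 i).
Proof.
exists (fun z => complex.Re (z 0 i)), (fun z => complex.Im (z 0 i)).
by split; [exact: Ratfun_Re|exact: Ratfun_Im|move=> z _; case: (z 0 i)].
Qed.

Lemma cratfun_conj F : cratfun F -> cratfun (fun z => (F z)^*).
Proof.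
move=> [a [b [ra rb FE]]]; exists a, (fun z => - b z).
by split; [|exact: ratfun_opp|move=> z Oz; rewrite FE].
Qed.

End RationalFunctions.

(** * The Bergman metric has rational coefficients *)

Section BergmanMetric.
Context {R : realType} {n : nat}.
Local Notation C := R[i].
Local Notation T := 'rV[C]_n.+1.
Variable Omega : set T.
Hypothesis oO : open Omega.
Implicit Types (f : T -> R) (F : T -> C).

(** Allows the derivative at 0 along a line to be computed from a formula that holds on [Omega]
    only. *)
Lemma near_line (v z : T) : Omega z -> \forall t \near (0 : R), Omega (z + t%:C *: v).
Proof.
move=> Oz; have /nbhs_ballP[e /= e0 zeO] := open_nbhs_nbhs (conj oO Oz).
have [e1 e10 ee] := gt0_complexE e0.
move: zeO; rewrite ee => zeO.
have [m vm] : exists m : R, `|v| = m%:C.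
  by exists (complex.Re `|v|); rewrite RRe_real// ger0_real.
have m0 : 0 <= m by rewrite -ler0c -vm.
(* [m + 1] and not [m], as [v] may be 0. *)
have d0 : 0 < e1 / (m + 1) by rewrite divr_gt0// ltr_wpDl.
apply/nbhs_ballP; exists (e1 / (m + 1)) => //= t; rewrite /ball /= sub0r normrN => td.
apply: zeO; rewrite -ball_normE /= opprD addrA subrr sub0r normrN normrZ vm.
rewrite normCE normc_real -rmorphM ltcR.
rewrite (le_lt_trans (_ : _ <= `|t| * (m + 1)))//.
  by rewrite ler_wpM2l// lerDl.
by rewrite -ltr_pdivlMr// ltr_wpDl.
Qed.

Lemma cratfun_dir_derive (v : T) F : cratfun Omega F ->
  cratfun Omega (dir_derive v F).
Proof.
move=> [a [b [ra rb FE]]].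
have [g rg ag] := ratfun_derive v ra; have [k rk bk] := ratfun_derive v rb.
exists g, k; split => // z Oz; rewrite /dir_derive; congr (_ +i* _).
- rewrite derive1E -(near_eq_derive (f := fun t : R => a (z + t%:C *: v))).
    by have := ag z Oz => ?; rewrite derive_val.
  by near do rewrite FE//; exact: near_line.
- rewrite derive1E -(near_eq_derive (f := fun t : R => b (z + t%:C *: v))).
    by have := bk z Oz => ?; rewrite derive_val.
  by near do rewrite FE//; exact: near_line.
Unshelve. all: by end_near. Qed.

Variables (p : nat) (h : T -> T -> C).
Hypothesis hpoly : sesqui_polynomial h.
Hypothesis hpos : forall z, Omega z -> 0 < h z z.

Lemma cratfun_diag : cratfun Omega (fun z => h z z).
Proof.
have [N [c hE]] := hpoly.
rewrite (_ : (fun z => h z z) = fun z => \sum_a \sum_b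
  c a b * (\prod_i ((z 0 i)^* ^+ a i) * \prod_i (z 0 i ^+ b i))); last exact/funext.
apply: cratfun_sum => a; apply: cratfun_sum => b.
apply: cratfun_mul; first exact: cratfun_cst.
apply: cratfun_mul; apply: cratfun_prod => i; apply: cratfun_exp.
  by apply: cratfun_conj; exact: cratfun_coord.
exact: cratfun_coord.
Qed.

Lemma diag_real z : Omega z -> h z z = (complex.Re (h z z))%:C.
Proof. by move=> Oz; rewrite RRe_real// gtr0_real// hpos. Qed.

Lemma diag_gt0 z : Omega z -> 0 < complex.Re (h z z).
Proof. by move=> Oz; rewrite -ltcR -diag_real// hpos. Qed.

Lemma ratfun_diag : exists2 q, ratfun Omega q &
  forall z, Omega z -> complex.Re (h z z) = q z.
Proof.
by have [a [b [ra rb hE]]] := cratfun_diag; exists a => // z Oz; rewrite hE.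
Qed.

Lemma Re_diagV z : Omega z -> complex.Re (h z z ^- p) = complex.Re (h z z) ^- p.
Proof. by move=> Oz; rewrite diag_real// -rmorphXn -fmorphV. Qed.

(** The logarithm is not rational, but its first derivatives [u' / u] with [u = h^-p] are. The
    metric takes one further derivative, which stays within rational functions. *)
Lemma cratfun_log_kernel (v : T) :
  cratfun Omega (dir_derive v (fun z => (log_kernel p h z)%:C)).
Proof.
have [q rq qE] := ratfun_diag.
have q0 z : Omega z -> 0 < q z by move=> Oz; rewrite -qE// diag_gt0.
pose u z := (q z ^+ p)^-1.
have qp0 z : Omega z -> q z ^+ p != 0 by move=> /q0 qz; rewrite expf_neq0 ?gt_eqF.
have ru : ratfun Omega u by apply: Ratfun_inv => //; exact: ratfun_exp.
have u0 z : Omega z -> 0 < u z by move=> Oz; rewrite invr_gt0 exprn_gt0 ?q0.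
have [g rg ug] := ratfun_derive v ru.
exists (fun z => (u z)^-1 * g z), (fun=> 0); split; last first.
- move=> z Oz; rewrite /dir_derive /=; congr (_ +i* _); last first.
    by rewrite derive1E; exact: derive_cst.
  rewrite derive1E -(near_eq_derive (f := (@ln R) \o (fun t : R => u (z + t%:C *: v)))).
    have D1 := ug z Oz.
    have D2 : is_derive (u (z + (0 : R)%:C *: v)) 1 (@ln R) (u z)^-1.
      by rewrite scale0r addr0; apply: is_derive1_ln; exact: u0.
    have D3 := @is_derive1_comp R (@ln R) (fun t : R => u (z + t%:C *: v)) _ _ _ D2 D1; by rewrite derive_val.
  near=> t; rewrite /= /log_kernel; have Ot : Omega (z + t%:C *: v).
    by near: t; exact: near_line.
  by rewrite Re_diagV// qE.
- exact: Ratfun_cst.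
- by apply: Ratfun_mul => //; apply: Ratfun_inv => // z /u0 /gt_eqF ->.
Unshelve. all: by end_near. Qed.

Lemma cratfun_metric i j : cratfun Omega (bergman_metric p h i j).
Proof.
have aux F (c : C) : cratfun Omega F -> cratfun Omega (fun z => c * F z).
  by move=> rF; apply: cratfun_mul => //; exact: cratfun_cst.
have auxN F : cratfun Omega F -> cratfun Omega (fun z => - F z).
  by move=> /(aux _ (-1)); under eq_fun do rewrite mulN1r.
have rb : cratfun Omega (wirtinger_bar j (fun z => (log_kernel p h z)%:C)).
  by apply: (aux); apply: cratfun_add; last apply: (aux); exact: cratfun_log_kernel.
apply: (aux); apply: cratfun_add; last (apply: (auxN); apply: (aux));
  exact: cratfun_dir_derive.
Qed.

Lemma cratfun_bounded F z : cratfun Omega F -> Omega z ->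
  exists2 M : R, 0 <= M & \forall t \near z, Normc.normc (F t) <= M.
Proof.
move=> [a [b [ra rb FE]]] Oz.
exists (`|a z| + 1 + (`|b z| + 1)); first by rewrite !addr_ge0.
have bnd (f : T -> R) : ratfun Omega f -> \forall t \near z, `|f t| <= `|f z| + 1.
  move=> rf; have /cvgrPdist_lt /(_ 1 ltr01) := ratfun_continuous rf Oz.
  apply: filterS => t ft; rewrite -lerBlDl (le_trans (lerB_dist _ _))//.
  by rewrite distrC ltW.
near=> t; have Ot : Omega t by near: t; exact: open_nbhs_nbhs.
rewrite FE// (le_trans (normc_le_ReIm _))//= lerD//.
  by near: t; exact: bnd.
by near: t; exact: bnd.
Unshelve. all: by end_near. Qed.

(** Rational coefficients are bounded near [z]. The bound is linear in the sup norm of [xi] and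
    uniform over a neighbourhood, as the length of a short segment requires. *)
Lemma vector_length_bounded z : Omega z ->
  exists2 M : R, 0 <= M & \forall t \near z,
    forall (xi : T) (e : R), 0 <= e -> (forall i, Normc.normc (xi 0 i) <= e) ->
    vector_length p h t xi <= M * e.
Proof.
move=> Oz.
have /choice[B BP] : forall ij : 'I_n.+1 * 'I_n.+1, exists M : R, 0 <= M /\
    \forall t \near z, Normc.normc (bergman_metric p h ij.1 ij.2 t) <= M.
  by move=> ij; have [M M0 MP] := cratfun_bounded (cratfun_metric ij.1 ij.2) Oz; exists M.
exists (Num.sqrt (\sum_i \sum_j B (i, j))) => //.
near=> t => xi e e0 xie.
have tB ij : Normc.normc (bergman_metric p h ij.1 ij.2 t) <= B ij.
  by move: ij; near: t; apply: filter_forall => ij; have [] := BP ij.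
rewrite -[e in leRHS]ger0_norm// -sqrtr_sqr -sqrtrM; last first.
  by apply: sumr_ge0 => i _; apply: sumr_ge0 => j _; have [] := BP (i, j).
apply: ler_wsqrtr; rewrite raddf_sum mulr_suml; apply: ler_sum => i _.
rewrite raddf_sum mulr_suml; apply: ler_sum => j _.
apply: (le_trans (ler_norm _)); apply: (le_trans (normr_Re_le _)).
rewrite Normc.normcM (Normc.normcM (bergman_metric _ _ _ _ _)) normc_conj -mulrA expr2.
apply: ler_pM; first exact: normc_ge0.
- by rewrite mulr_ge0 ?normc_ge0.
- exact: (tB (i, j)).
- by apply: ler_pM; rewrite ?normc_ge0.
Unshelve. all: by end_near. Qed.

(** * The Bergman distance: triangle inequality and open balls *)

Lemma C1_path_cat z u w s s' : C1_path Omega z s u -> C1_path Omega u s' w ->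
  C1_path Omega z (s ++ s') w.
Proof.
elim: s z => [|c s ih] z /= => [->//|[c1 c2 c3 c4] us'].
by split => //; exact: ih.
Qed.

Lemma curve_length_ge0 c : (0 <= curve_length p h c)%E.
Proof. by apply: integral_ge0 => t _; rewrite lee_fin sqrtr_ge0. Qed.

Lemma bergman_dist_ge0 z w : (0 <= bergman_dist Omega p h z w)%E.
Proof.
apply/ereal_infP => _ [s _ <-].
by apply: sume_ge0 => c _; exact: curve_length_ge0.
Qed.

(** A strict bound on the infimum yields an actual path below it, and the two paths are
    concatenated. *)
Lemma bergman_dist_triangle z u w (s t : R) :
  (bergman_dist Omega p h z u < s%:E)%E ->
  (bergman_dist Omega p h u w < t%:E)%E ->
  (bergman_dist Omega p h z w < (s + t)%:E)%E.
Proof.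
move=> /ereal_inf_lt[_ [c cP <-] cs] /ereal_inf_lt[_ [c' cP' <-] ct].
apply: (@le_lt_trans _ _ (\sum_(e <- c ++ c') curve_length p h e)%E).
  by apply: ereal_inf_lbound; exists (c ++ c') => //; exact: C1_path_cat cP cP'.
by rewrite big_cat /= EFinD lteD.
Qed.

Hypothesis convexO : forall (t : R) z w, 0 <= t <= 1 -> Omega z -> Omega w ->
  Omega (t%:C *: z + (1 - t)%:C *: w).

Lemma segment_coord (w v : T) i :
  (fun t : R => complex.Re ((w + t%:C *: v) 0 i)) =
     (fun t => complex.Re (w 0 i) + t * complex.Re (v 0 i)) /\
  (fun t : R => complex.Im ((w + t%:C *: v) 0 i)) =
     (fun t => complex.Im (w 0 i) + t * complex.Im (v 0 i)).
Proof.
split; apply/funext => t; rewrite !mxE; case: (w 0 i) (v 0 i) => a b [x y] /=.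
  by rewrite mul0r subr0.
by rewrite mul0r addr0.
Qed.

(** The straight segment from [w] to [w'] stays in [Omega] by convexity, and its length is at most a
    local bound [M] of the metric times the sup norm of [w' - w]. *)
Lemma bergman_dist_near w (e : R) : Omega w -> 0 < e ->
  \forall w' \near w, (bergman_dist Omega p h w w' < e%:E)%E.
Proof.
move=> Ow e0; have [M M0 /nbhs_ballP[d /= d0 MP]] := vector_length_bounded Ow.
have [d1 d10 dd] := gt0_complexE d0.
move: MP; rewrite dd => MP.
(* With [M + 1] the quotient makes sense for [M = 0], and [M * k < e]. *)
pose k := e / (M + 1).
have k0 : 0 < k by rewrite divr_gt0// ltr_wpDl.
near=> w'; have Ow' : Omega w' by near: w'; exact: open_nbhs_nbhs.
have wd : ball w d1%:C w' by near: w'; apply: nbhsx_ballx; rewrite ltcR.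
have wk : ball w k%:C w' by near: w'; apply: nbhsx_ballx; rewrite ltcR.
pose v := w' - w; pose c (t : R) := w + t%:C *: v.
have cvel t : velocity c t = v.
  apply/rowP => i; rewrite mxE /c; have [cR cI] := segment_coord w v i.
  rewrite cR cI.
  have D1 := is_derive_affine (complex.Re (w 0 i)) (complex.Re (v 0 i)) t.
  have D2 := is_derive_affine (complex.Im (w 0 i)) (complex.Im (v 0 i)) t.
  by rewrite !derive1E !derive_val; case: (v 0 i).
apply: (@le_lt_trans _ _ (\sum_(e <- [:: c]) curve_length p h e)%E).
  apply: ereal_inf_lbound; exists [:: c] => //=; split.
  - move=> i; rewrite /c; have [cR cI] := segment_coord w v i.
    have dE a b : derive1 (fun s : R => a + s * b) = cst b.
      apply/funext => t; rewrite derive1E.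
      by have D := is_derive_affine a b t; rewrite derive_val.
    rewrite cR cI; split.
    + by move=> t; have [] := is_derive_affine (complex.Re (w 0 i)) (complex.Re (v 0 i)) t.
    + by move=> t; have [] := is_derive_affine (complex.Im (w 0 i)) (complex.Im (v 0 i)) t.
    + by rewrite dE; exact: cst_continuous.
    + by rewrite dE; exact: cst_continuous.
  - move=> t t01; rewrite (_ : c t = t%:C *: w' + (1 - t)%:C *: w); first exact: convexO.
    by rewrite /c /v scalerBr rmorphB rmorph1 scalerBl scale1r addrCA addrC.
  - by rewrite /c scale0r addr0.
  - by rewrite /c scale1r /v addrC subrK.
rewrite big_seq1 /curve_length.
apply: (@le_lt_trans _ _ (\int[lebesgue_measure]_(t in `[0%R, 1%R]) (M * k)%:E)%E).
  apply: ge0_le_integral_nomeas => [t _|t /=]; first by rewrite lee_fin sqrtr_ge0.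
  rewrite in_itv /= => /andP[t0 t1]; rewrite lee_fin cvel; apply: MP.
  - rewrite -ball_normE /= /c opprD addrA subrr sub0r normrN normrZ normCE normc_real.
    rewrite ger0_norm//; move: wd; rewrite -ball_normE /= distrC; apply: le_lt_trans.
    by rewrite ler_piMl// -[leRHS]/(1%:C) lecR.
  - exact: ltW.
  - move=> i; case: wk => _ /(_ 0 i); rewrite -ball_normE /= distrC normCE ltcR.
    by rewrite /v !mxE => /ltW.
rewrite integral_cst//= lebesgue_measure_itv /= lte01 oppr0 adde0 mule1 lte_fin.
by rewrite /k mulrA ltr_pdivrMr ?ltr_wpDl// mulrC ltr_pM2l// ltrDl.
Unshelve. all: by end_near. Qed.

(** A point [w] of the ball is at distance less than some [s < rho], and the points within [rho - s]
    of [w] contain a neighbourhood of [w]. *)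
Lemma bergman_ball_open z (rho : R) :
  open [set w | Omega w /\ (bergman_dist Omega p h z w < rho%:E)%E].
Proof.
rewrite openE => w [Ow zw] /=.
have [s [zs sr]] : exists s : R, (bergman_dist Omega p h z w < s%:E)%E /\ s < rho.
  have := bergman_dist_ge0 z w; move: zw.
  case: (bergman_dist Omega p h z w) => // a; rewrite lte_fin => ar _.
  by exists ((a + rho) / 2); rewrite lte_fin !midf_lt.
near=> w'; split; first by near: w'; exact: open_nbhs_nbhs.
rewrite -[rho](subrKC s); apply: (bergman_dist_triangle zs).
by near: w'; apply: bergman_dist_near => //; rewrite subr_gt0.
Unshelve. all: by end_near. Qed.

End BergmanMetric.

(** * Complex-valued integrals *)

Section ComplexIntegral.
Context {R : realType} {n : nat}.
Local Notation C := R[i].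
Local Notation T := 'rV[C]_n.+1.
Variables (Omega : set T) (vol : {measure set (borel T) -> \bar R}).
Hypothesis oO : open Omega.
Implicit Types (F G : T -> C).

Let mO : measurable (Omega : set (borel T)) := open_borel oO.

(** Componentwise, as [complex_integral] integrates the real and imaginary parts separately. *)
Definition cmeasurable F :=
  measurable_fun (Omega : set (borel T)) (fun z => complex.Re (F z)) /\
  measurable_fun (Omega : set (borel T)) (fun z => complex.Im (F z)).

Lemma cmeasurable_continuous F : (forall z, Omega z -> {for z, continuous F}) ->
  cmeasurable F.
Proof.
move=> cF; split; apply: continuous_in_measurable => // z Oz.
  by apply: continuous_comp; [exact: cF|exact: Re_continuous].
by apply: continuous_comp; [exact: cF|exact: Im_continuous].
Qed.

Lemma cmeasurable_mul F G : cmeasurable F -> cmeasurable G ->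
  cmeasurable (fun z => F z * G z).
Proof.
move=> [Fr Fi] [Gr Gi]; split.
  rewrite (_ : (fun _ => _) = (fun z => complex.Re (F z) * complex.Re (G z)
    - complex.Im (F z) * complex.Im (G z))).
    by apply: measurable_funB; exact: measurable_funM.
  by apply/funext => z; case: (F z) (G z) => a b [c e].
rewrite (_ : (fun _ => _) = (fun z => complex.Re (F z) * complex.Im (G z)
  + complex.Im (F z) * complex.Re (G z))).
  by apply: measurable_funD; exact: measurable_funM.
by apply/funext => z; case: (F z) (G z) => a b [c e].
Qed.

Lemma cmeasurable_conj F : cmeasurable F -> cmeasurable (fun z => (F z)^*).
Proof.
move=> [Fr Fi]; split.
  by rewrite (_ : (fun _ => _) = (fun z => complex.Re (F z)))//;
    apply/funext => z; case: (F z).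
rewrite (_ : (fun _ => _) = (\- (fun z => complex.Im (F z)))%R).
  exact: measurableT_comp.
by apply/funext => z /=; case: (F z).
Qed.

Lemma cmeasurable_real (f : T -> R) :
  measurable_fun (Omega : set (borel T)) f -> cmeasurable (fun z => (f z)%:C).
Proof. by move=> mf; split; [exact: mf|exact: measurable_cst]. Qed.

Lemma measurable_normc F : cmeasurable F ->
  measurable_fun (Omega : set (borel T)) (fun z => Normc.normc (F z)).
Proof.
move=> [Fr Fi].
rewrite (_ : (fun _ => _) =
  (fun z => Num.sqrt (complex.Re (F z) ^+ 2 + complex.Im (F z) ^+ 2))); last first.
  by apply/funext => z; case: (F z).
apply: (measurableT_comp (f := @Num.sqrt R)).
  by apply: continuous_measurable_fun => x; exact: sqrt_continuous.
by apply: measurable_funD; exact: measurable_funX.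
Qed.

Definition cintegrable F :=
  cmeasurable F /\ (\int[vol]_(z in Omega) (Normc.normc (F z))%:E < +oo)%E.

Lemma cintegrable_normc F : cintegrable F ->
  vol.-integrable Omega (EFin \o (fun z => Normc.normc (F z))).
Proof.
move=> [mF Foo]; apply/integrableP; split.
  by apply/measurable_EFinP; exact: measurable_normc.
by under eq_integral do rewrite /= ger0_norm ?normc_ge0//.
Qed.

Lemma cintegrable_Re F : cintegrable F ->
  vol.-integrable Omega (EFin \o (fun z => complex.Re (F z))).
Proof.
move=> iF; apply: le_integrable (cintegrable_normc iF) => //.
  by apply/measurable_EFinP; case: iF => -[].
by move=> z _; rewrite /= lee_fin (ger0_norm (normc_ge0 _)) normr_Re_le.
Qed.

Lemma cintegrable_Im F : cintegrable F ->
  vol.-integrable Omega (EFin \o (fun z => complex.Im (F z))).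
Proof.
move=> iF; apply: le_integrable (cintegrable_normc iF) => //.
  by apply/measurable_EFinP; case: iF => -[].
by move=> z _; rewrite /= lee_fin (ger0_norm (normc_ge0 _)) normr_Im_le.
Qed.

Lemma cintegrable_le F (g : T -> R) : cmeasurable F ->
  vol.-integrable Omega (EFin \o g) ->
  (forall z, Omega z -> Normc.normc (F z) <= g z) -> cintegrable F.
Proof.
move=> mF /integrableP[mg goo] Fg; split => //; apply: le_lt_trans goo.
apply: ge0_le_integral_nomeas => z Oz; rewrite ?lee_fin ?normc_ge0//=.
by rewrite (le_trans (Fg _ Oz))// ler_norm.
Qed.

Local Notation cint F := (complex_integral Omega vol F).

Lemma complex_integral_lin (c : C) F G : cintegrable F -> cintegrable G ->
  cint (fun z => c * F z + G z) = c * cint F + cint G.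
Proof.
move=> iF iG; case: c => a b.
have [Fr Fi] := (cintegrable_Re iF, cintegrable_Im iF).
have [Gr Gi] := (cintegrable_Re iG, cintegrable_Im iG).
have iZ (f : T -> R) (k : R) : vol.-integrable Omega (EFin \o f) ->
    vol.-integrable Omega (EFin \o (fun z => k * f z)).
  by move=> fi; exact: (integrableZl mO k fi).
have iD (f g : T -> R) : vol.-integrable Omega (EFin \o f) ->
    vol.-integrable Omega (EFin \o g) ->
    vol.-integrable Omega (EFin \o (fun z => f z + g z)).
  by move=> fi gi; exact: (integrableD mO fi gi).
have cre z : complex.Re ((a +i* b) * F z + G z) =
    (a * complex.Re (F z) + (- b) * complex.Im (F z)) + complex.Re (G z).
  by case: (F z) (G z) => x y [u v] /=; rewrite mulNr.
have cim z : complex.Im ((a +i* b) * F z + G z) =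
    (a * complex.Im (F z) + b * complex.Re (F z)) + complex.Im (G z).
  by case: (F z) (G z) => x y [u v] /=.
rewrite /complex_integral.
rewrite (@eq_Rintegral _ _ _ vol Omega _ _ (fun (z : borel T) _ => cre z)).
rewrite (@eq_Rintegral _ _ _ vol Omega _ _ (fun (z : borel T) _ => cim z)).
rewrite !RintegralD//; try by [exact: (iZ) | apply: (iD); exact: (iZ)].
rewrite !RintegralZl//.
by apply/eqP; rewrite eq_complex /= mulNr !eqxx.
Qed.

Lemma complex_integral_conj F : cintegrable F ->
  cint (fun z => (F z)^*) = (cint F)^*.
Proof.
move=> iF; rewrite /complex_integral; apply/eqP; rewrite eq_complex /=; apply/andP; split.
  by apply/eqP; apply: eq_Rintegral => z _; case: (F z).
apply/eqP; rewrite -mulN1r -RintegralZl//; last exact: cintegrable_Im.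
by apply: eq_Rintegral => z _; case: (F z) => x y; rewrite /= mulN1r.
Qed.

(** The factor 2 comes from bounding the real and imaginary parts separately. It passes into the
    constant of the estimate for products, whose size is irrelevant. *)
Lemma le_complex_integral F : cintegrable F ->
  ((Normc.normc (cint F))%:E <= 2%:E * \int[vol]_(z in Omega) (Normc.normc (F z))%:E)%E.
Proof.
move=> iF.
apply: (@le_trans _ _ (`|complex.Re (cint F)|%:E + `|complex.Im (cint F)|%:E)%E).
  by rewrite -EFinD lee_fin normc_le_ReIm.
rewrite (_ : 2%:E = 1 + 1)%E ?ge0_muleDl ?mul1e//; apply: leeD => /=.
  rewrite EFin_normr_Rintegral//; last exact: cintegrable_Re.
  apply: (le_trans (le_abse_integral _ _ _)) => //.
    by apply/measurable_EFinP; case: iF => -[].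
  by apply: ge0_le_integral_nomeas => z _; rewrite ?lee_fin ?normr_Re_le//.
rewrite EFin_normr_Rintegral//; last exact: cintegrable_Im.
apply: (le_trans (le_abse_integral _ _ _)) => //.
  by apply/measurable_EFinP; case: iF => -[].
by apply: ge0_le_integral_nomeas => z _; rewrite ?lee_fin ?normr_Im_le//.
Qed.

End ComplexIntegral.

(** * Weighted Bergman spaces and their inner product *)

(** From [(u + v)^2 <= 2 u^2 + 2 v^2]. It takes the place of Minkowski's inequality, both for the
    closure of the Bergman space under linear combinations and for the bounds of operators. *)
Lemma normc_lin_sqr (R : realType) (c x y : R[i]) :
  Normc.normc (c * x + y) ^+ 2 <=
  2 * Normc.normc c ^+ 2 * Normc.normc x ^+ 2 + 2 * Normc.normc y ^+ 2.
Proof.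
have := le_normcD (c * x) y; rewrite Normc.normcM.
have := normc_ge0 (c * x + y); move: (Normc.normc (_ + _)) => s s0 sle.
rewrite -mulrA -exprMn; move: (_ * _) (Normc.normc y) sle => u v suv.
apply: (@le_trans _ _ ((u + v) ^+ 2)); first by rewrite lerXn2r// nnegrE// (le_trans s0).
by have := sqr_ge0 (u - v); nra.
Qed.

Section BergmanSpace.
Context {R : realType} {n : nat}.
Local Notation C := R[i].
Local Notation T := 'rV[C]_n.+1.
Variables (Omega : set T) (vol : {measure set (borel T) -> \bar R}).
Variable wt : T -> R.
Hypothesis oO : open Omega.
Hypothesis wt_ge0 : forall z, Omega z -> 0 <= wt z.
Hypothesis mwt : measurable_fun (Omega : set (borel T)) wt.
Implicit Types (f g k : T -> C).

Local Notation A2 := (bergman_space Omega vol wt).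
Local Notation "<< f , g >>" := (inner Omega vol wt f g).
Local Notation norm := (norm2 Omega vol wt).

Let mO : measurable (Omega : set (borel T)) := open_borel oO.

Lemma bergman_cmeasurable f : A2 f -> cmeasurable Omega f.
Proof.
by case=> _ hf _; apply: cmeasurable_continuous => // z /hf; exact: differentiable_continuous.
Qed.

Lemma bergman_sqr_integrable f : A2 f ->
  vol.-integrable Omega (EFin \o (fun z => Normc.normc (f z) ^+ 2 * wt z)).
Proof.
move=> Af; have mf := bergman_cmeasurable Af; case: Af => _ _ foo.
apply/integrableP; split.
  apply/measurable_EFinP; apply: measurable_funM => //.
  by apply: measurable_funX; exact: measurable_normc.
apply: le_lt_trans foo; apply: ge0_le_integral_nomeas => z Oz //=.
by rewrite lee_fin ger0_norm// mulr_ge0 ?sqr_ge0 ?wt_ge0.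
Qed.

Lemma normc_inner_integrand f g z : Omega z ->
  Normc.normc (f z * (g z)^* * (wt z)%:C) =
  Normc.normc (f z) * Normc.normc (g z) * wt z.
Proof.
by move=> Oz; rewrite 2!Normc.normcM normc_conj normc_real ger0_norm ?wt_ge0.
Qed.

Lemma inner_integrable f g : A2 f -> A2 g ->
  cintegrable Omega vol (fun z => f z * (g z)^* * (wt z)%:C).
Proof.
move=> Af Ag.
(* Dominated by [|f|^2 wt + |g|^2 wt], as [x y <= x^2 + y^2]. *)
apply: (@cintegrable_le _ _ _ _ _
  (fun z => Normc.normc (f z) ^+ 2 * wt z + Normc.normc (g z) ^+ 2 * wt z)).
- apply: cmeasurable_mul; last exact: cmeasurable_real.
  apply: cmeasurable_mul; first exact: bergman_cmeasurable.
  by apply: cmeasurable_conj; exact: bergman_cmeasurable.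
- exact: (integrableD mO (bergman_sqr_integrable Af) (bergman_sqr_integrable Ag)).
- move=> z Oz; rewrite normc_inner_integrand// -mulrDl ler_wpM2r ?wt_ge0//.
  have := normc_ge0 (f z); have := normc_ge0 (g z); nra.
Qed.

Lemma bergman_lin (c : C) f g : A2 f -> A2 g -> A2 (fun z => c * f z + g z).
Proof.
move=> Af Ag; have [f0 hf foo] := Af; have [g0 hg goo] := Ag; split.
- by move=> z nOz; rewrite f0// g0// mulr0 addr0.
- move=> z Oz; apply: differentiableD; last exact: hg.
  by apply: differentiableZ; exact: hf.
- have i1 := integrableZl mO (2 * Normc.normc c ^+ 2) (bergman_sqr_integrable Af).
  have i2 := integrableZl mO 2 (bergman_sqr_integrable Ag).
  have /integrableP[_] := integrableD mO i1 i2.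
  apply: le_lt_trans; apply: ge0_le_integral_nomeas => z Oz /=.
      by rewrite lee_fin; apply: mulr_ge0; [exact: sqr_ge0|exact: wt_ge0].
  rewrite lee_fin ger0_norm; last first.
    have s0 (u : C) : 0 <= Normc.normc u ^+ 2 * wt z.
      by apply: mulr_ge0; [exact: sqr_ge0|exact: wt_ge0].
    by apply: addr_ge0; apply: mulr_ge0 => //; apply: mulr_ge0 => //; exact: sqr_ge0.
  rewrite [leRHS](_ : _ = (2 * Normc.normc c ^+ 2 * Normc.normc (f z) ^+ 2
    + 2 * Normc.normc (g z) ^+ 2) * wt z); last by ring.
  by rewrite ler_wpM2r ?wt_ge0// normc_lin_sqr.
Qed.

Lemma bergman0 : A2 (fun=> 0).
Proof.
split=> [//|z _|]; first exact: differentiable_cst.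
by rewrite (eq_integral (fun=> 0%E)) ?integral0// => z _; rewrite Normc.normc0 expr0n /= mul0r.
Qed.

Lemma bergman_scale (c : C) f : A2 f -> A2 (fun z => c * f z).
Proof.
move=> Af; rewrite (_ : (fun _ => _) = (fun z => c * f z + 0)).
  exact: bergman_lin Af bergman0.
by apply/funext => z; rewrite addr0.
Qed.

Lemma inner_linl (c : C) f g k : A2 f -> A2 g -> A2 k ->
  << (fun z => c * f z + g z), k >> = c * << f, k >> + << g, k >>.
Proof.
move=> Af Ag Ak; rewrite /inner -complex_integral_lin//; try exact: inner_integrable.
by congr complex_integral; apply/funext => z; rewrite !mulrDl !mulrA.
Qed.

Lemma inner_conj f g : A2 f -> A2 g -> << g, f >> = (<< f, g >>)^*.
Proof.
move=> Af Ag; rewrite /inner -complex_integral_conj//; last exact: inner_integrable.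
congr complex_integral; apply/funext => z.
by rewrite !rmorphM /= conjcK oppr0 [X in _ = X * _]mulrC.
Qed.

Lemma inner_linr (c : C) f g k : A2 f -> A2 g -> A2 k ->
  << k, (fun z => c * f z + g z) >> = c^* * << k, f >> + << k, g >>.
Proof.
move=> Af Ag Ak; rewrite inner_conj//; last exact: bergman_lin.
by rewrite inner_linl// rmorphD rmorphM /= (inner_conj Af Ak) (inner_conj Ag Ak).
Qed.

Lemma le_inner f g : A2 f -> A2 g ->
  ((Normc.normc << f, g >>)%:E <=
   2%:E * \int[vol]_(z in Omega) (Normc.normc (f z) * Normc.normc (g z) * wt z)%:E)%E.
Proof.
move=> Af Ag; apply: (le_trans (le_complex_integral oO (inner_integrable Af Ag))).
rewrite lee_pmul2l//; apply: ge0_le_integral_nomeas => z Oz; rewrite lee_fin ?normc_ge0//.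
by rewrite normc_inner_integrand.
Qed.

Lemma inner_diag f : << f, f >> =
  (Rintegral vol Omega (fun z => Normc.normc (f z) ^+ 2 * wt z))%:C.
Proof.
rewrite /inner /complex_integral; congr (_ +i* _).
  apply: eq_Rintegral => z _; case: (f z) => x y /=; rewrite sqr_sqrtr; last first.
    by rewrite addr_ge0 ?sqr_ge0.
  by rewrite mulr0 subr0 mulrN opprK !expr2.
rewrite (@eq_Rintegral _ _ _ vol Omega (fun=> 0)); first by rewrite /Rintegral integral0.
move=> z _; by case: (f z) => x y /=; ring.
Qed.

Lemma sqr_norm2 f : norm f ^+ 2 =
  Rintegral vol Omega (fun z => Normc.normc (f z) ^+ 2 * wt z).
Proof.
rewrite /norm2 inner_diag sqr_sqrtr//; apply: Rintegral_ge0 => z Oz.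
by rewrite mulr_ge0 ?sqr_ge0 ?wt_ge0.
Qed.

Lemma norm2_lin (c : C) f g : A2 f -> A2 g ->
  norm (fun z => c * f z + g z) ^+ 2 <=
  2 * Normc.normc c ^+ 2 * norm f ^+ 2 + 2 * norm g ^+ 2.
Proof.
move=> Af Ag.
have i1 := integrableZl mO (2 * Normc.normc c ^+ 2) (bergman_sqr_integrable Af).
have i2 := integrableZl mO 2 (bergman_sqr_integrable Ag).
rewrite !sqr_norm2 -!RintegralZl//; try exact: bergman_sqr_integrable.
rewrite -RintegralD//; apply: le_Rintegral => //.
- exact: (bergman_sqr_integrable (bergman_lin c Af Ag)).
- exact: (integrableD mO i1 i2).
- move=> z Oz.
  rewrite [leRHS](_ : _ = (2 * Normc.normc c ^+ 2 * Normc.normc (f z) ^+ 2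
    + 2 * Normc.normc (g z) ^+ 2) * wt z); last by ring.
  by rewrite ler_wpM2r ?wt_ge0// normc_lin_sqr.
Qed.

End BergmanSpace.

(** * Bounded operators and adjoints *)

Section BoundedOperators.
Context {R : realType} {n : nat}.
Local Notation C := R[i].
Local Notation T := 'rV[C]_n.+1.
Variables (Omega : set T) (vol : {measure set (borel T) -> \bar R}).
Variables (h : T -> T -> C) (nu : R).
Local Notation wt := (bergman_weight Omega vol h nu).
Hypothesis oO : open Omega.
Hypothesis wt_ge0 : forall z, Omega z -> 0 <= wt z.
Hypothesis mwt : measurable_fun (Omega : set (borel T)) wt.

Local Notation A2 := (bergman_space Omega vol wt).
Local Notation norm := (norm2 Omega vol wt).
Local Notation bounded := (bounded_operator Omega vol h nu).
Local Notation adjoint := (adjoint Omega vol h nu).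
Implicit Types S : (T -> C) -> T -> C.

Lemma norm2_0 : norm (fun=> 0) = 0.
Proof.
suff : norm (fun=> 0) ^+ 2 = 0 by move/eqP; rewrite expf_eq0 => /eqP.
rewrite (sqr_norm2 _ wt_ge0) (@eq_Rintegral _ _ _ vol Omega (fun=> 0)).
  by rewrite /Rintegral integral0.
by move=> z _; rewrite Normc.normc0 expr0n mul0r.
Qed.

Lemma norm2_ge0 f : 0 <= norm f.
Proof. exact: sqrtr_ge0. Qed.

Lemma bounded_operator0 : bounded (fun _ _ => 0).
Proof.
split => //.
- by move=> f _; exact: bergman0.
- by move=> c f g _ _; apply/funext => z; rewrite mulr0 addr0.
- by exists 0 => f _; rewrite norm2_0 mul0r.
Qed.

Lemma bounded_operator_lin (c : C) S1 S2 : bounded S1 -> bounded S2 ->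
  bounded (fun f z => c * S1 f z + S2 f z).
Proof.
move=> [S10 S1A S1l [M1 M1P]] [S20 S2A S2l [M2 M2P]]; split.
- by move=> f nAf; rewrite S10// S20//; apply/funext => z; rewrite mulr0 addr0.
- by move=> f Af; apply: bergman_lin => //; [exact: S1A|exact: S2A].
- by move=> k f g Af Ag; rewrite S1l// S2l//; apply/funext => z; ring.
(* The bound is read off the squared estimate [norm2_lin], hence the square root. *)
exists (Num.sqrt (2 * Normc.normc c ^+ 2 * M1 ^+ 2 + 2 * M2 ^+ 2)) => f Af.
have sq S M : norm (S f) <= M * norm f -> norm (S f) ^+ 2 <= M ^+ 2 * norm f ^+ 2.
  move=> le; rewrite -exprMn lerXn2r// nnegrE ?norm2_ge0//.
  exact: le_trans (norm2_ge0 _) le.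
have N0 := norm2_ge0 f.
rewrite -[norm f]ger0_norm// -sqrtr_sqr -sqrtrM; last first.
  by apply: addr_ge0; rewrite mulr_ge0 ?sqr_ge0// mulr_ge0 ?sqr_ge0.
rewrite -[leLHS]ger0_norm ?norm2_ge0// -sqrtr_sqr ler_wsqrtr//.
apply: (le_trans (norm2_lin oO wt_ge0 mwt _ (S1A _ Af) (S2A _ Af))).
rewrite [leRHS]mulrDl lerD//; last first.
  by rewrite -[leRHS]mulrA ler_wpM2l//; exact/sq/M2P.
rewrite -[leRHS]mulrA ler_wpM2l//; first by rewrite mulr_ge0 ?sqr_ge0.
exact/sq/M1P.
Qed.

Lemma bounded_operator_comp S1 S2 : bounded S1 -> bounded S2 -> bounded (S1 \o S2).
Proof.
move=> [S10 S1A S1l [M1 M1P]] [S20 S2A S2l [M2 M2P]]; split.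
- move=> f nAf; rewrite /= S20//.
  (* [S2 f] is the zero function here, and linearity with coefficient [-1] forces [S1] to send 0 to
     0. *)
  have := S1l (-1) _ _ (bergman0 Omega vol wt) (bergman0 Omega vol wt).
  rewrite (_ : (fun z => -1 * 0 + 0) = fun=> 0); last first.
    by apply/funext => z; rewrite mulr0 addr0.
  by move=> ->; apply/funext => z; rewrite mulN1r addNr.
- by move=> f Af; exact/S1A/S2A.
- by move=> c f g Af Ag; rewrite /= S2l// S1l//; exact: S2A.
(* The absolute value is there because [M1] is not assumed nonnegative. *)
exists (`|M1| * M2) => f Af; rewrite /= -mulrA.
apply: (le_trans (M1P _ (S2A _ Af))).
apply: (@le_trans _ _ (`|M1| * norm (S2 f))).
  by rewrite ler_wpM2r ?norm2_ge0// ler_norm.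
by rewrite ler_wpM2l//; exact: M2P.
Qed.

Lemma adjoint0 : adjoint (fun _ _ => 0) (fun _ _ => 0).
Proof.
split=> [|f g Af Ag]; first exact: bounded_operator0.
have i0 k : A2 k -> inner Omega vol wt (fun=> 0) k = 0.
  move=> Ak; have A0 := bergman0 Omega vol wt.
  have := inner_linl oO wt_ge0 mwt (-1) A0 A0 Ak.
  rewrite (_ : (fun z => -1 * 0 + 0) = fun=> 0).
    by move=> ->; rewrite mulN1r addNr.
  by apply/funext => z; rewrite mulr0 addr0.
rewrite i0// inner_conj//; last exact: bergman0.
by rewrite i0// conjc0.
Qed.

Lemma adjoint_sym S S' : bounded S -> adjoint S S' -> adjoint S' S.
Proof.
move=> bS [[_ S'A _ _] SS']; have [_ SA _ _] := bS; split => // f g Af Ag.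
have AS'f := S'A _ Af; have ASg := SA _ Ag.
by rewrite (inner_conj oO wt_ge0 mwt Ag AS'f) -SS'// -inner_conj.
Qed.

Lemma adjoint_lin (c : C) S1 S1' S2 S2' : bounded S1 -> bounded S2 ->
  adjoint S1 S1' -> adjoint S2 S2' ->
  adjoint (fun f z => c * S1 f z + S2 f z) (fun f z => c^* * S1' f z + S2' f z).
Proof.
move=> [_ S1A _ _] [_ S2A _ _] [bS1' SS1] [bS2' SS2].
split; first exact: bounded_operator_lin.
move=> f g Af Ag; have [_ S1A' _ _] := bS1'; have [_ S2A' _ _] := bS2'.
have A1 := S1A _ Af; have A2 := S2A _ Af; have A1' := S1A' _ Ag; have A2' := S2A' _ Ag.
by rewrite inner_linl// inner_linr// conjCK SS1// SS2.
Qed.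

Lemma adjoint_comp S1 S1' S2 S2' : bounded S1 -> bounded S2 ->
  adjoint S1 S1' -> adjoint S2 S2' -> adjoint (S1 \o S2) (S2' \o S1').
Proof.
move=> [_ S1A _ _] [_ S2A _ _] [bS1' SS1] [bS2' SS2].
split; first exact: bounded_operator_comp.
move=> f g Af Ag; have [_ S1A' _ _] := bS1'.
have A1 := S2A _ Af; have A1' := S1A' _ Ag.
by rewrite /= SS1// SS2.
Qed.

End BoundedOperators.

(** * The reproducing kernel and its norm *)

Section Kernel.
Context {R : realType} {n : nat}.
Local Notation C := R[i].
Local Notation T := 'rV[C]_n.+1.
Variables (Omega : set T) (vol : {measure set (borel T) -> \bar R}).
Variables (p : nat) (h : T -> T -> C) (nu : R) (K : T -> T -> C).
Local Notation wt := (bergman_weight Omega vol h nu).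
Hypothesis oO : open Omega.
Hypothesis hpoly : sesqui_polynomial h.
Hypothesis hpos : forall z, Omega z -> 0 < h z z.
Hypothesis hK : weighted_kernel Omega vol p h nu K.

Local Notation A2 := (bergman_space Omega vol wt).
Local Notation "<< f , g >>" := (inner Omega vol wt f g).
Local Notation norm := (norm2 Omega vol wt).
Local Notation kn := (normalized_kernel Omega vol wt K).
Local Notation c_nu := (Rintegral vol Omega (hpow h nu))^-1.

Lemma hpow_gt0 (s : R) z : Omega z -> 0 < hpow h s z.
Proof. by move=> Oz; rewrite powR_gt0 ?(diag_gt0 hpos). Qed.

Lemma measurable_hpow (s : R) : measurable_fun (Omega : set (borel T)) (hpow h s).
Proof.
apply: (measurableT_comp (measurable_powR s)).
have [q rq qE] := ratfun_diag Omega hpoly.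
apply: (@eq_measurable_fun _ _ _ _ (Omega : set (borel T)) q).
  by move=> z /[!inE] Oz; rewrite qE.
by apply: continuous_in_measurable => //; exact: ratfun_continuous.
Qed.

Lemma c_nu_ge0 : 0 <= c_nu.
Proof. by rewrite invr_ge0 Rintegral_ge0// => z Oz; rewrite ltW ?hpow_gt0. Qed.

Lemma bergman_weight_ge0 z : Omega z -> 0 <= wt z.
Proof. by move=> Oz; rewrite mulr_ge0 ?c_nu_ge0// ltW ?hpow_gt0. Qed.

Lemma measurable_bergman_weight : measurable_fun (Omega : set (borel T)) wt.
Proof. by apply: measurable_funM; [exact: measurable_cst|exact: measurable_hpow]. Qed.

Lemma normc_cexp (u : C) : Normc.normc (cexp u) = expR (complex.Re u).
Proof.
rewrite /cexp Normc.normcM normc_real ger0_norm ?expR_ge0//=.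
by rewrite cos2Dsin2 sqrtr1 mulr1.
Qed.

(** By the reproducing property [||K_z||^2 = K_z(z)]. Taking moduli leaves only the real part of
    [L z z], and [|exp (L z z)| = h z z] determines it as [ln (h z z)]. *)
Lemma sqr_norm_kernel z : Omega z -> norm (K z) ^+ 2 = hpow h (- (nu + p%:R)) z.
Proof.
move=> Oz; have [rK [L [_ Lh _] KL]] := hK; have [AK KE] := rK z Oz.
have N0 : 0 <= norm (K z) ^+ 2 by exact: sqr_ge0.
have : Normc.normc (K z z) = norm (K z) ^+ 2.
  rewrite (KE _ AK) inner_diag.
  by rewrite normc_real -sqr_norm2 ?ger0_norm//; exact: bergman_weight_ge0.
move=> <-; rewrite KL// normc_cexp.
have hz := diag_gt0 hpos Oz.
have LR : complex.Re (L z z) = ln (complex.Re (h z z)).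
  rewrite -[LHS]expRK -normc_cexp Lh// (diag_real hpos Oz) normc_real ger0_norm//.
  exact: ltW.
rewrite /hpow /powR gt_eqF// -LR; congr expR.
by case: (L z z) => x y /=; ring.
Qed.

Lemma norm_kernel_gt0 z : Omega z -> 0 < norm (K z).
Proof.
move=> Oz; rewrite lt_neqAle norm2_ge0 andbT eq_sym; apply/eqP => N0.
by have := hpow_gt0 (- (nu + p%:R)) Oz; rewrite -sqr_norm_kernel// N0 expr0n ltxx.
Qed.

Lemma measurable_norm_kernelV :
  measurable_fun (Omega : set (borel T)) (fun z => (norm (K z))^-1).
Proof.
apply: (@eq_measurable_fun _ _ _ _ (Omega : set (borel T))
  (@Num.sqrt R \o hpow h (nu + p%:R))).
  move=> z /[!inE] Oz; rewrite -[RHS]ger0_norm ?invr_ge0 ?norm2_ge0//.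
  rewrite -sqrtr_sqr exprVn sqr_norm_kernel//= /hpow.
  by rewrite -powRN opprK.
apply: measurableT_comp; last exact: measurable_hpow.
by apply: continuous_measurable_fun => x; exact: sqrt_continuous.
Qed.

Lemma norm_kernel_weight z : Omega z ->
  norm (K z) ^+ 2 * wt z = c_nu * complex.Re (h z z) ^- p.
Proof.
move=> Oz; rewrite sqr_norm_kernel// /bergman_weight mulrCA; congr (_ * _).
have hz := diag_gt0 hpos Oz.
rewrite /hpow -powRD; last by rewrite (gt_eqF hz) /= implybT.
by rewrite opprD addrAC addNr add0r powRN powR_mulrn// ltW.
Qed.

Lemma bergman_normalized_kernel z : Omega z -> A2 (kn z).
Proof.
move=> Oz; have [rK _] := hK; have [AK _] := rK z Oz.
rewrite /normalized_kernel (_ : (fun w => _) = (fun w => ((norm (K z))%:C)^-1 * K z w)).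
  apply: bergman_scale => //; [exact: bergman_weight_ge0|exact: measurable_bergman_weight].
by apply/funext => w; rewrite mulrC.
Qed.

Lemma inner_normalized_kernel f z : Omega z -> A2 f ->
  << f, kn z >> = f z / (norm (K z))%:C.
Proof.
move=> Oz Af; have [rK _] := hK; have [AK KE] := rK z Oz.
(* The reproducing property is applied to [f / ||K_z||]: the real scalar moves from one side of the
   inner product to the other inside the integral. *)
have Ag : A2 (fun w => ((norm (K z))%:C)^-1 * f w).
  apply: bergman_scale => //; [exact: bergman_weight_ge0|exact: measurable_bergman_weight].
rewrite mulrC (KE _ Ag) /inner; congr complex_integral; apply/funext => w.
rewrite /normalized_kernel.
have -> : Num.conj (K z w / (norm (K z))%:C) = Num.conj (K z w) * ((norm (K z))%:C)^-1.
  by rewrite rmorphM fmorphV; congr (_ * _^-1); exact: conjc_real.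
by congr (_ * _); rewrite [LHS]mulrA [LHS]mulrC [LHS]mulrA.
Qed.

End Kernel.

(** * Matrix coefficients, and [I_loc] as a supremum of integrals over the domain *)

Section Localization.
Context {R : realType} {n : nat}.
Local Notation C := R[i].
Local Notation T := 'rV[C]_n.+1.
Variables (Omega : set T) (vol : {measure set (borel T) -> \bar R}).
Variables (p : nat) (h : T -> T -> C) (nu : R) (K : T -> T -> C).
Variables (muG : {measure set (borelG Omega) -> \bar R}) (alpha : R).
Local Notation wt := (bergman_weight Omega vol h nu).
Hypothesis oO : open Omega.
Hypothesis O0 : Omega 0.
Hypothesis convexO : forall (t : R) z w, 0 <= t <= 1 -> Omega z -> Omega w ->
  Omega (t%:C *: z + (1 - t)%:C *: w).
Hypothesis vol_fin : (vol setT < +oo)%E.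
Hypothesis hpoly : sesqui_polynomial h.
Hypothesis hpos : forall z, Omega z -> 0 < h z z.
Hypothesis hK : weighted_kernel Omega vol p h nu K.
Hypothesis haar : normalized_haar vol p h muG.

Local Notation A2 := (bergman_space Omega vol wt).
Local Notation "<< f , g >>" := (inner Omega vol wt f g).
Local Notation norm := (norm2 Omega vol wt).
Local Notation kn := (normalized_kernel Omega vol wt K).
Local Notation c_nu := (Rintegral vol Omega (hpow h nu))^-1.
Local Notation bounded := (bounded_operator Omega vol h nu).
Local Notation adjoint := (adjoint Omega vol h nu).
Local Notation dist := (bergman_dist Omega p h).
Local Notation I_loc := (I_loc vol p h nu K muG alpha).
Local Notation ha := (hpow h alpha).
Implicit Types S : (T -> C) -> T -> C.

Let mO : measurable (Omega : set (borel T)) := open_borel oO.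
Let wt_ge0 : forall z, Omega z -> 0 <= wt z :=
  @bergman_weight_ge0 _ _ _ vol _ nu hpos.
Let mwt : measurable_fun (Omega : set (borel T)) wt :=
  measurable_bergman_weight vol nu oO hpoly.

Lemma act_in (x : autG Omega) z : Omega z -> Omega (act x z).
Proof.
move=> Oz; have /connected_component_sub[_ [y [_ _ xy _ _]]] := svalP x.
by have [] := xy z Oz.
Qed.

Lemma repr_pi_one (x : autG Omega) :
  repr_pi vol h nu K x (Defs.one_fun Omega) = kn (act x 0).
Proof.
have /connected_component_sub[xid [y [xy yx _ _ _]]] := svalP x.
have [rK _] := hK; have [[K0 _ _] _] := rK _ (act_in x O0).
apply/funext => w; rewrite /repr_pi; have [Ow|nOw] := pselect (Omega w); last first.
  by rewrite /normalized_kernel K0// !mul0r.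
rewrite /Defs.one_fun /zero_ext ifT ?mulr1// inE /act_inv.
(* [act_inv] picks the preimage [z] of [w], which exists since [x] is onto. It lies in [Omega]:
   otherwise [x] would fix it, and [w = z] would lie outside [Omega]. *)
case: xgetP => [z _ /= xz|/(_ (y w)) nE]; last by case: nE; exact: yx.
by apply: contrapT => nOz; apply: (nOz); rewrite -(xid _ nOz) -/(act x z) xz.
Qed.

Definition Mloc S z w : R := Normc.normc << S (kn z), kn w >>.
(** Density of the invariant measure with respect to [vol]. *)
Definition hp u : R := complex.Re (h u u) ^- p.
Definition far (rho : R) z : set T := [set w | Omega w /\ ~ (dist z w < rho%:E)%E].
(** The integrand of [I_loc] as a function on the whole space, extended by 0 from [far rho z], in
    the form that [normalized_haar] takes. *)
Definition Eloc S rho z : T -> \bar R :=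
  (fun w => (Mloc S z w * (ha w / ha z))%:E) \_ (far rho z).
(** The integral inside [I_loc], carried over to [Omega], with an arbitrary point [z] in place of
    [x . 0]. *)
Definition Jloc S rho z : \bar R := (\int[vol]_(w in Omega) (Eloc S rho z w * (hp w)%:E))%E.

Lemma hp_gt0 u : Omega u -> 0 < hp u.
Proof.
by move=> Ou; rewrite /hp invr_gt0 exprn_gt0// (diag_gt0 hpos).
Qed.

Lemma measurable_hp : measurable_fun (Omega : set (borel T)) hp.
Proof.
apply: (@eq_measurable_fun _ _ _ _ (Omega : set (borel T)) (hpow h (- p%:R))).
  move=> z /[!inE] Oz; rewrite /hp /hpow powRN powR_mulrn//.
  exact/ltW/(diag_gt0 hpos).
exact: measurable_hpow.
Qed.

Lemma measurable_far rho z : measurable (far rho z : set (borel T)).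
Proof.
rewrite (_ : far rho z = Omega `\` [set w | Omega w /\ (dist z w < rho%:E)%E]).
  by apply: measurableD => //; apply: open_borel; exact: bergman_ball_open.
apply/seteqP; split => w [Ow nw]; split => //; first by case.
by move=> ?; exact: nw.
Qed.

Lemma far0 z : far 0 z = Omega.
Proof.
apply/seteqP; split => w; first by case.
by move=> Ow; split => //; apply/negP; rewrite -leNgt bergman_dist_ge0.
Qed.

Lemma far_triangle (s t : R) z u w : far (s + t) z w -> Omega u ->
  (dist z u < s%:E)%E -> far t u w.
Proof.
move=> [Ow nw] Ou zu; split => // uw; apply: nw.
exact: bergman_dist_triangle zu uw.
Qed.

Lemma MlocE S z w : bounded S -> Omega z -> Omega w ->
  Mloc S z w = Normc.normc (S (kn z) w) / norm (K w).
Proof.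
move=> [_ SA _ _] Oz Ow; have kA := bergman_normalized_kernel oO hpoly hpos hK Oz.
rewrite /Mloc (inner_normalized_kernel oO hpoly hpos hK Ow (SA _ kA)).
by rewrite Normc.normcM Normc.normcV normc_real (ger0_norm (norm2_ge0 _ _ _ _ _)).
Qed.

Lemma Mloc_ge0 S z w : 0 <= Mloc S z w.
Proof. exact: normc_ge0. Qed.

Lemma ratio_ge0 z w : 0 <= ha w / ha z.
Proof. by rewrite divr_ge0 ?powR_ge0. Qed.

Lemma Eloc_ge0 S rho z w : (0 <= Eloc S rho z w)%E.
Proof.
by apply: erestrict_ge0 => t _; rewrite lee_fin mulr_ge0 ?Mloc_ge0 ?ratio_ge0.
Qed.

Lemma Eloc_in S rho z w : far rho z w ->
  Eloc S rho z w = (Mloc S z w * (ha w / ha z))%:E.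
Proof. by move=> fw; rewrite /Eloc patchE mem_set. Qed.

Lemma Eloc_out S rho z w : ~ far rho z w -> Eloc S rho z w = 0%E.
Proof. by move=> nfw; rewrite /Eloc patchE memNset. Qed.

Lemma measurable_Mloc S z : bounded S -> Omega z ->
  measurable_fun (Omega : set (borel T)) (Mloc S z).
Proof.
move=> bS Oz; apply: (@eq_measurable_fun _ _ _ _ (Omega : set (borel T))
   (fun w => Normc.normc (S (kn z) w) * (norm (K w))^-1)).
  by move=> w /[!inE] Ow; rewrite MlocE.
apply: measurable_funM.
  apply: measurable_normc; apply: bergman_cmeasurable => //.
  by case: bS => _ SA _ _; apply: SA; exact: bergman_normalized_kernel hK _ Oz.
exact: measurable_norm_kernelV hK.
Qed.

Lemma measurable_Eloc S rho z : bounded S -> Omega z ->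
  measurable_fun (setT : set (borel T)) (Eloc S rho z).
Proof.
move=> bS Oz; apply: (iffLR (measurable_restrictT _ (measurable_far rho z))).
apply/measurable_EFinP; apply: (@measurable_funS _ _ _ _ (Omega : set (borel T))) => //.
  by move=> w [].
apply: measurable_funM; first exact: measurable_Mloc.
by apply: measurable_funM; [exact: measurable_hpow|exact: measurable_cst].
Qed.

Lemma Jloc_haar S rho z : bounded S -> Omega z ->
  Jloc S rho z = (\int[muG]_y Eloc S rho z (act y 0))%E.
Proof.
move=> bS Oz; have mE := measurable_Eloc rho bS Oz.
by rewrite (haar.2 _ mE (Eloc_ge0 S rho z)).
Qed.

Lemma I_locE S rho : bounded S ->
  I_loc S rho = ereal_sup [set Jloc S rho (act x 0) | x in [set: autG Omega]].
Proof.
move=> bS; rewrite /Defs.I_loc; congr ereal_sup.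
apply: eq_imagel => x _; rewrite Jloc_haar//; last exact: act_in.
rewrite integral_mkcond; apply: eq_integral => y _.
rewrite /Eloc !patchE !repr_pi_one /Mloc.
have -> : (y \in ~` Gball p h rho x) = (act y 0 \in far rho (act x 0)); last by [].
apply/idP/idP; rewrite !inE /Gball /far /=; last by case.
by move=> ?; split => //; exact: act_in.
Qed.

Lemma Jloc_ge0 S rho z : (0 <= Jloc S rho z)%E.
Proof.
apply: integral_ge0 => w Ow; rewrite mule_ge0 ?Eloc_ge0// lee_fin.
exact/ltW/hp_gt0.
Qed.

Lemma Jloc_le_I S rho (x : autG Omega) : bounded S ->
  (Jloc S rho (act x 0) <= I_loc S rho)%E.
Proof. by move=> bS; rewrite I_locE//; apply: ereal_sup_ubound; exists x. Qed.

(** A supremum over an empty set would be [-oo]; [point], the identity of the group, provides a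
    nonnegative term. *)
Lemma I_loc_ge0 S rho : bounded S -> (0 <= I_loc S rho)%E.
Proof. by move=> bS; exact: le_trans (Jloc_ge0 _ _ _) (Jloc_le_I _ point bS). Qed.

Lemma I_loc0 rho : I_loc (fun _ _ => 0) rho = 0%E.
Proof.
have b0 := bounded_operator0 wt_ge0.
apply/eqP; rewrite eq_le I_loc_ge0// andbT I_locE//.
apply: ge_ereal_sup => _ [x _ <-].
rewrite /Jloc [leLHS](_ : _ = 0%E)//.
under eq_integral => w /[!inE] Ow.
  rewrite /Eloc patchE MlocE//; last exact: act_in.
  rewrite Normc.normc0 !mul0r /= if_same mul0e; over.
exact: integral0.
Qed.

Lemma I_loc_lin (c : C) S1 S2 rho : bounded S1 -> bounded S2 ->
  (I_loc (fun f z => (c * S1 f z + S2 f z)%R) rho <=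
   (Normc.normc c)%:E * I_loc S1 rho + I_loc S2 rho)%E.
Proof.
move=> b1 b2; have b12 := bounded_operator_lin oO wt_ge0 mwt c b1 b2.
rewrite I_locE//; apply: ge_ereal_sup => _ [x _ <-].
have Ox := act_in x O0.
have J1 := Jloc_le_I rho x b1; have J2 := Jloc_le_I rho x b2.
apply: (@le_trans _ _ ((Normc.normc c)%:E * Jloc S1 rho (act x 0) + Jloc S2 rho (act x 0))%E); last first.
  by apply: leeD J2; apply: lee_wpmul2l J1; rewrite lee_fin normc_ge0.
have mhp : measurable_fun (Omega : set (borel T)) (EFin \o hp).
  by apply/measurable_EFinP; exact: measurable_hp.
have mE S : bounded S -> measurable_fun (Omega : set (borel T))
    (fun w => Eloc S rho (act x 0) w * (hp w)%:E)%E.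
  move=> bS; apply: emeasurable_funM => //.
  by apply: (@measurable_funS _ _ _ _ setT) => //; exact: measurable_Eloc.
have E0 S w : Omega w -> (0 <= Eloc S rho (act x 0) w * (hp w)%:E)%E.
  by move=> Ow; rewrite mule_ge0 ?Eloc_ge0// lee_fin; exact/ltW/hp_gt0.
rewrite /Jloc -ge0_integralZl//; try by [exact: mE | exact: E0 | rewrite lee_fin normc_ge0].
have E10 w : Omega w -> (0 <= (Normc.normc c)%:E * (Eloc S1 rho (act x 0) w * (hp w)%:E))%E.
  by move=> Ow; rewrite mule_ge0 ?E0// lee_fin normc_ge0.
rewrite -(ge0_integralD vol mO E10 _ (E0 S2)); last 2 first.
- by apply: measurable_funeM; exact: mE.
- exact: mE.
apply: ge0_le_integral_nomeas => w Ow; first exact: E0.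
rewrite muleA -ge0_muleDl ?Eloc_ge0//; last first.
  by rewrite mule_ge0 ?Eloc_ge0// lee_fin normc_ge0.
apply: lee_wpmul2r; first by rewrite lee_fin; exact/ltW/hp_gt0.
rewrite /Eloc !patchE; case: ifPn => _; last by rewrite mule0 adde0.
rewrite -EFinM -EFinD lee_fin [X in _ <= X + _]mulrA -mulrDl ler_wpM2r ?ratio_ge0//.
rewrite !MlocE// [X in _ <= X + _]mulrA -mulrDl ler_wpM2r ?invr_ge0 ?norm2_ge0//.
by rewrite (le_trans (le_normcD _ _))// Normc.normcM.
Qed.

(** * Joint measurability and the estimate for products *)

(** Conjugate symmetry of the inner product. It turns the first variable into the point at which the
    holomorphic function [S' (kn w)] is evaluated, up to the factor [1 / ||K_u||]. *)
Lemma Mloc_adjoint S S' u w : bounded S -> adjoint S S' -> Omega u -> Omega w ->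
  Mloc S u w = Mloc S' w u.
Proof.
move=> [_ SA _ _] [[_ S'A _ _] SS'] Ou Ow.
have ku := bergman_normalized_kernel oO hpoly hpos hK Ou.
have kw := bergman_normalized_kernel oO hpoly hpos hK Ow.
rewrite /Mloc SS'// (inner_conj oO wt_ge0 mwt (S'A _ kw) ku); exact: normc_conj.
Qed.

Lemma measurable_Mloc_l S S' w : bounded S -> adjoint S S' -> Omega w ->
  measurable_fun (Omega : set (borel T)) (fun u => Mloc S u w).
Proof.
move=> bS SS' Ow; apply: (@eq_measurable_fun _ _ _ _ (Omega : set (borel T)) (Mloc S' w)).
  by move=> u /[!inE] Ou; rewrite (Mloc_adjoint bS SS').
by apply: measurable_Mloc => //; case: SS'.
Qed.

(** Without the factor [1 / ||K_u||], the coefficient is the function [f]. It is continuous in [u]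
    for fixed [w], being the modulus of a holomorphic function, and measurable in [w] for fixed [u],
    being [||K_u||] times a matrix coefficient of [S]. *)
Lemma measurable_Mloc2 S S' : bounded S -> adjoint S S' ->
  measurable_fun (Omega `*` Omega : set (borel T * borel T))
    (fun x => Mloc S x.1 x.2).
Proof.
move=> bS SS'; have [bS' _] := SS'.
pose f u w := Normc.normc (S' (kn w) u).
have fE u w : Omega u -> Omega w -> Mloc S u w = f u w / norm (K u).
  by move=> Ou Ow; rewrite (Mloc_adjoint bS SS')// MlocE.
have mf : measurable_fun (Omega `*` Omega : set (borel T * borel T)) (fun x => f x.1 x.2).
  apply: caratheodory_measurable => // [w Ow z Oz|z Oz].
    apply: continuous_comp; last exact: normc_continuous.
    apply: differentiable_continuous; have [_ S'A _ _] := bS'.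
    have kw := bergman_normalized_kernel oO hpoly hpos hK Ow.
    by have [_ hol _] := S'A _ kw; exact: hol.
  apply: (@eq_measurable_fun _ _ _ _ (Omega : set (borel T))
      (fun w => Mloc S z w * norm (K z))).
    move=> w /[!inE] Ow; rewrite fE// divfK// gt_eqF//.
    exact: norm_kernel_gt0 hK _ Oz.
  by apply: measurable_funM; [exact: measurable_Mloc|exact: measurable_cst].
apply: (@eq_measurable_fun _ _ _ _ (Omega `*` Omega : set (borel T * borel T))
   (fun x => f x.1 x.2 * (norm (K x.1))^-1)).
  by move=> [u w] /[!inE] -[/= Ou Ow]; rewrite fE.
apply: measurable_funM => //.
have mV := measurable_norm_kernelV oO hpoly hpos hK.
exact: measurable_funX_fst mV.
Qed.

Lemma Mloc_comp_le S1 S1' S2 z w : bounded S1 -> adjoint S1 S1' -> bounded S2 ->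
  Omega z -> Omega w ->
  ((Mloc (S1 \o S2) z w)%:E <= (2 * c_nu)%:E *
    \int[vol]_(u in Omega) (Mloc S2 z u * Mloc S1 u w * hp u)%:E)%E.
Proof.
move=> b1 a1 b2 Oz Ow; have [b1' S1S1'] := a1.
have kz := bergman_normalized_kernel oO hpoly hpos hK Oz.
have kw := bergman_normalized_kernel oO hpoly hpos hK Ow.
have [_ S2A _ _] := b2; have [_ S1'A _ _] := b1'.
have -> : Mloc (S1 \o S2) z w = Normc.normc << S2 (kn z), S1' (kn w) >>.
  by rewrite -(S1S1' _ _ (S2A _ kz) kw).
apply: (le_trans (le_inner oO wt_ge0 mwt (S2A _ kz) (S1'A _ kw))).
rewrite EFinM -muleA lee_wpmul2l// -ge0_integralZl//; last 3 first.
- apply/measurable_EFinP; apply: measurable_funM; last exact: measurable_hp.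
  by apply: measurable_funM; [exact: measurable_Mloc|exact: measurable_Mloc_l a1 _].
- move=> u Ou; rewrite lee_fin mulr_ge0 ?mulr_ge0 ?normc_ge0//.
  exact/ltW/hp_gt0.
- by rewrite lee_fin (c_nu_ge0 _ _ hpos).
apply: ge0_le_integral_nomeas => u Ou.
  by rewrite lee_fin; apply: mulr_ge0; [apply: mulr_ge0; exact: normc_ge0|exact: wt_ge0].
rewrite -EFinM lee_fin.
rewrite (MlocE b2 Oz Ou) (Mloc_adjoint b1 a1 Ou Ow) (MlocE b1' Ow Ou).
have n0 := norm_kernel_gt0 hpos hK Ou.
have := norm_kernel_weight hpos hK Ou; rewrite -/(hp u) => nw.
have nn0 : norm (K u) != 0 by rewrite gt_eqF.
move: (norm (K u)) (hp u) nn0 nw => nu_ hpu nn0 nw.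
(* The weight provides [||K_u||^-2], which matches the two denominators [||K_u||] coming from
   [MlocE], and leaves the factor [c_nu]. *)
have -> : wt u = nu_ ^- 2 * (c_nu * hpu) by rewrite -nw mulKf// expf_neq0.
move: (c_nu) (Normc.normc _) (Normc.normc _) => c x y.
by rewrite le_eqVlt; apply/orP; left; apply/eqP; field.
Qed.

Lemma Jloc_integrand_ge0 S rho z w : Omega w -> (0 <= Eloc S rho z w * (hp w)%:E)%E.
Proof. by move=> Ow; apply: mule_ge0; [exact: Eloc_ge0|rewrite lee_fin; exact/ltW/hp_gt0]. Qed.

(** Under the double integral everything splits into a factor [a] in [(z, u)] and a factor [e] in
    [(u, w)]. After Tonelli, the integral [Phi u] of [e] over [w] is compared with [Jloc S1] at the
    point [u]. *)
Lemma Jloc_comp_le S1 S1' S2 (s t : R) (x : autG Omega) :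
  bounded S1 -> adjoint S1 S1' -> bounded S2 ->
  (Jloc (S1 \o S2) (s + t) (act x 0) <= (2 * c_nu)%:E *
    (I_loc S1 0 * Jloc S2 s (act x 0) + I_loc S1 t * Jloc S2 0 (act x 0)))%E.
Proof.
move=> b1 a1 b2; have Oz := act_in x O0; move: (act x 0) Oz => z Oz.
have b12 := bounded_operator_comp b1 b2.
have mfar := measurable_far (s + t) z.
have farO w : far (s + t) z w -> Omega w by case.
have hp0 u : Omega u -> 0 <= hp u by move=> /hp_gt0/ltW.
have num0 S z' u : Omega u -> 0 <= Mloc S z' u * (ha u / ha z') * hp u.
  by move=> Ou; apply: mulr_ge0 (hp0 _ Ou); apply: mulr_ge0 (ratio_ge0 _ _); exact: Mloc_ge0.
(* [e (u, w)] is the weighted coefficient of [S1], cut off to [w] far from [z]. It is introduced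
   through its properties so that its body stays opaque; the same device serves for [a], [G], [Phi],
   [F] and [H]. *)
have [e [eIn eOut e0 me]] : exists e : T * T -> \bar R,
    [/\ forall u w, Omega u -> far (s + t) z w ->
          e (u, w) = (Mloc S1 u w * (ha w / ha u) * hp w)%:E,
        forall u w, ~ far (s + t) z w -> e (u, w) = 0%E,
        forall q, (0 <= e q)%E
      & measurable_fun (setT : set (borel T * borel T)) e].
  exists ((fun q => (Mloc S1 q.1 q.2 * (ha q.2 / ha q.1) * hp q.2)%:E) \_
           (Omega `*` far (s + t) z)); split.
  - by move=> u w Ou fw; rewrite patchE mem_set.
  - by move=> u w nfw; rewrite patchE memNset// => -[].
  - by apply: erestrict_ge0 => -[u w] [_ /farO Ow]; rewrite lee_fin; exact: num0.
  apply: (iffLR (measurable_restrictT _ (measurableX mO mfar))).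
  have sub : Omega `*` far (s + t) z `<=` Omega `*` Omega.
    by move=> [u w] [/= Ou /farO].
  have mOO : measurable (Omega `*` Omega : set (borel T * borel T)) by exact: measurableX.
  apply/measurable_EFinP; apply: (measurable_funS mOO sub).
  have mha r : measurable_fun (Omega : set (borel T)) (hpow h r) by exact: measurable_hpow.
  have c2 (f : borel T -> R) (mf : measurable_fun (Omega : set (borel T)) f) :=
    @measurable_funX_snd _ _ _ (borel T) (borel T) _ Omega Omega f mO mf.
  have c1 (f : borel T -> R) (mf : measurable_fun (Omega : set (borel T)) f) :=
    @measurable_funX_fst _ _ _ (borel T) (borel T) _ Omega Omega f mO mf.
  apply: measurable_funM; last exact: (c2 _ measurable_hp).
  apply: measurable_funM; first exact: (measurable_Mloc2 b1 a1).
  apply: measurable_funM; first exact: (c2 _ (mha alpha)).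
  (* [1 / ha u] is the power of [h(u,u)] with exponent [- alpha], hence measurable like [ha]. *)
  apply: (@eq_measurable_fun _ _ _ _ (Omega `*` Omega : set (borel T * borel T))
     (hpow h (- alpha) \o fst)); last exact: (c1 _ (mha (- alpha))).
  by move=> [u w] _; rewrite /hpow /= powRN.
have [a [aIn aOut a0 ma]] : exists a : T -> \bar R,
    [/\ forall u, Omega u -> a u = (Mloc S2 z u * (ha u / ha z) * hp u)%:E,
        forall u, ~ Omega u -> a u = 0%E,
        forall u, (0 <= a u)%E
      & measurable_fun (setT : set (borel T)) a].
  exists ((fun u => (Mloc S2 z u * (ha u / ha z) * hp u)%:E) \_ Omega); split.
  - by move=> u Ou; rewrite patchE mem_set.
  - by move=> u nOu; rewrite patchE memNset.
  - by apply: erestrict_ge0 => u Ou; rewrite lee_fin; exact: num0.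
  apply: (iffLR (measurable_restrictT _ mO)); apply/measurable_EFinP.
  apply: measurable_funM; last exact: measurable_hp.
  apply: measurable_funM; first exact: measurable_Mloc.
  by apply: measurable_funM; [exact: measurable_hpow|exact: measurable_cst].
have [G GE] : exists G : T * T -> \bar R, forall q, G q = (a q.1 * e q)%E by eexists.
have mG : measurable_fun (setT : set (borel T * borel T)) G.
  rewrite (_ : G = (fun q => a q.1 * e q)%E); last exact/funext.
  by apply: emeasurable_funM me; exact: (measurableT_comp ma measurable_fst).
have G0 q : (0 <= G q)%E by rewrite GE; exact: mule_ge0.
have [_ mG2 GG] := finite_tonelli vol_fin mG G0.
have [Phi PhiE] : exists Phi : T -> \bar R, forall u, Phi u = (\int[vol]_w e (u, w))%E.
  by eexists.
have mPhi : measurable_fun (setT : set (borel T)) Phi.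
  rewrite (_ : Phi = (fun u => \int[vol]_w e (u, w))%E); last exact/funext.
  by have [] := finite_tonelli vol_fin me e0.
have Phi0 u : (0 <= Phi u)%E by rewrite PhiE; apply: integral_ge0 => w _; exact: e0.
(* Used with [t' = t] when [u] is within [s] of [z], and with [t' = 0] otherwise. *)
have Phi_le t' u : Omega u -> far (s + t) z `<=` far t' u -> (Phi u <= Jloc S1 t' u)%E.
  move=> Ou sub; rewrite PhiE /Jloc [leRHS]integral_mkcond.
  apply: ge0_le_integral_nomeas => w _; first exact: e0.
  have [fw|nfw] := pselect (far (s + t) z w); last first.
    by rewrite eOut//; apply: erestrict_ge0 => w'; exact: Jloc_integrand_ge0.
  rewrite eIn// patchE (mem_set (farO _ fw)) Eloc_in; last exact: sub.
  by rewrite -EFinM.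
have c0 : (0 <= (2 * c_nu)%:E)%E.
  by rewrite lee_fin; apply: mulr_ge0 => //; exact: (c_nu_ge0 _ _ hpos).
have intG0 w : (0 <= \int[vol]_u G (u, w))%E by apply: integral_ge0 => u _; exact: G0.
apply: (@le_trans _ _ (\int[vol]_w ((2 * c_nu)%:E * \int[vol]_u G (u, w)))%E).
  rewrite /Jloc integral_mkcond; apply: ge0_le_integral_nomeas => w _.
    by apply: erestrict_ge0 => w'; exact: Jloc_integrand_ge0.
  have [fw|nfw] := pselect (far (s + t) z w); last first.
    rewrite patchE Eloc_out// mul0e if_same.
    by apply: mule_ge0 c0 _; exact: intG0.
  have Ow := farO _ fw; rewrite patchE (mem_set Ow) Eloc_in//.
  have k0 : 0 <= ha w / ha z * hp w.
    by apply: mulr_ge0; [exact: ratio_ge0|exact: hp0].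
  rewrite -EFinM -mulrA EFinM.
  have := lee_wpmul2r (x := (ha w / ha z * hp w)%:E) _ (Mloc_comp_le b1 a1 b2 Oz Ow).
  rewrite lee_fin => /(_ k0) /le_trans; apply.
  rewrite -muleA; apply: lee_wpmul2l => //; rewrite -ge0_integralZr//; last 2 first.
  - apply/measurable_EFinP; apply: measurable_funM; last exact: measurable_hp.
    by apply: measurable_funM; [exact: measurable_Mloc|exact: measurable_Mloc_l a1 _].
  - move=> u Ou; rewrite lee_fin; apply: mulr_ge0 (hp0 _ Ou).
    by apply: mulr_ge0; exact: Mloc_ge0.
  rewrite integral_mkcond; apply: ge0_le_integral_nomeas => u _.
    apply: erestrict_ge0 => u' Ou; rewrite -EFinM lee_fin; apply: mulr_ge0 k0.
    by apply: mulr_ge0 (hp0 _ Ou); apply: mulr_ge0; exact: Mloc_ge0.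
  have [Ou|nOu] := pselect (Omega u); last by rewrite patchE memNset//; exact: G0.
  rewrite patchE (mem_set Ou) GE aIn// eIn// -!EFinM lee_fin.
  (* The weight ratio telescopes: [ha w / ha z = (ha u / ha z) * (ha w / ha u)]. *)
  have hu : ha u != 0 by apply: lt0r_neq0; exact: hpow_gt0 hpos _ _ _.
  have hz : ha z != 0 by apply: lt0r_neq0; exact: hpow_gt0 hpos _ _ _.
  move: (ha u) (ha z) (ha w) (hp u) (hp w) hu hz => hu hz hw pu pw hu0 hz0.
  move: (Mloc _ _ _) (Mloc _ _ _) => m1 m2.
  by rewrite le_eqVlt; apply/orP; left; apply/eqP; field; rewrite hz0 hu0.
rewrite (ge0_integralZl _ measurableT mG2 (fun w _ => intG0 w) c0).
apply: lee_wpmul2l => //; rewrite -GG.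
have aPhi u : (\int[vol]_w G (u, w) = a u * Phi u)%E.
  under eq_integral do rewrite GE /=.
  by rewrite PhiE ge0_integralZl//; exact: measurable_fun_pair2 me.
under eq_integral => u _ do rewrite aPhi.
have mE2 r := measurable_Eloc r b2 Oz.
have [F FE] : exists F : T -> \bar R, forall u, F u = (Eloc S2 0 z u * Phi u)%E by eexists.
have mF : measurable_fun (setT : set (borel T)) F.
  rewrite (_ : F = (fun u => Eloc S2 0 z u * Phi u)%E); last exact/funext.
  exact: emeasurable_funM (mE2 0) mPhi.
have F0 u : (0 <= F u)%E by rewrite FE; apply: mule_ge0 (Phi0 u); exact: Eloc_ge0.
(* Carrying the integral over [u] back to the group makes [u = y . 0], so that
   [I_loc S1] bounds [Phi u] without appealing to transitivity of the group. *)
have -> : (\int[vol]_u (a u * Phi u) = \int[muG]_y F (act y 0))%E.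
  rewrite (haar.2 _ mF F0) [RHS]integral_mkcond; apply: eq_integral => u _.
  have [Ou|nOu] := pselect (Omega u); last by rewrite patchE memNset// aOut// mul0e.
  rewrite patchE (mem_set Ou) FE aIn// Eloc_in ?far0// -/(hp u) EFinM.
  by rewrite [in RHS]muleAC.
(* The two terms of [H] bound [F] in the cases [dist z u >= s] and [dist z u < s] respectively. Both
   are nonnegative, so their sum is a majorant in either case. *)
have [H HE] : exists H : T -> \bar R, forall u, H u =
    (I_loc S1 0 * Eloc S2 s z u + I_loc S1 t * Eloc S2 0 z u)%E by eexists.
have I0 r : (0 <= I_loc S1 r)%E by exact: I_loc_ge0.
have mH : measurable_fun (setT : set (borel T)) H.
  rewrite (_ : H = (fun u =>
    I_loc S1 0 * Eloc S2 s z u + I_loc S1 t * Eloc S2 0 z u)%E); last exact/funext.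
  by apply: emeasurable_funD; apply: measurable_funeM; exact: mE2.
have IE0 r r' u : (0 <= I_loc S1 r * Eloc S2 r' z u)%E.
  by apply: mule_ge0; [exact: I0|exact: Eloc_ge0].
have H0 u : (0 <= H u)%E by rewrite HE; apply: adde_ge0; exact: IE0.
apply: (@le_trans _ _ (\int[muG]_y H (act y 0))%E).
  apply: ge0_le_integral_nomeas => y _; first exact: F0.
  have Ou := act_in y O0; have J1 r := Jloc_le_I r y b1.
  move: (act y 0) Ou J1 => u Ou J1; rewrite FE HE.
  have [zu|zu] := ltP (dist z u) s%:E.
    apply: (@le_trans _ _ (I_loc S1 t * Eloc S2 0 z u)%E); last first.
      by rewrite leeDr//; exact: IE0.
    rewrite muleC; apply: lee_wpmul2r; first exact: Eloc_ge0.
    apply: (le_trans (Phi_le t _ Ou _)); last exact: J1.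
    by move=> w fw; exact: far_triangle fw Ou zu.
  apply: (@le_trans _ _ (I_loc S1 0 * Eloc S2 s z u)%E); last first.
    by rewrite leeDl//; exact: IE0.
  rewrite Eloc_in ?far0// Eloc_in; last by split => //; apply/negP; rewrite -leNgt.
  rewrite muleC; apply: lee_wpmul2r.
    by rewrite lee_fin; apply: mulr_ge0; [exact: Mloc_ge0|exact: ratio_ge0].
  by apply: (le_trans (Phi_le 0 _ Ou _)); [rewrite far0|exact: J1].
rewrite (haar.2 _ mH H0).
have mE r : measurable_fun (Omega : set (borel T)) (fun u => Eloc S2 r z u * (hp u)%:E)%E.
  apply: emeasurable_funM; first exact: measurable_funTS (mE2 r).
  by apply/measurable_EFinP; exact: measurable_hp.
rewrite /Jloc -(ge0_integralZl _ mO (mE s) (fun u => Jloc_integrand_ge0 S2 s z (w := u)) (I0 0)).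
rewrite -(ge0_integralZl _ mO (mE 0) (fun u => Jloc_integrand_ge0 S2 0 z (w := u)) (I0 t)).
rewrite -ge0_integralD//; last 4 first.
- by move=> u Ou; apply: mule_ge0; [exact: I0|exact: Jloc_integrand_ge0].
- by apply: measurable_funeM; exact: mE.
- by move=> u Ou; apply: mule_ge0; [exact: I0|exact: Jloc_integrand_ge0].
- by apply: measurable_funeM; exact: mE.
rewrite le_eqVlt; apply/orP; left; apply/eqP; apply: eq_integral => u _.
by rewrite HE ge0_muleDl; [rewrite -!muleA|exact: IE0|exact: IE0].
Qed.

Lemma I_loc_comp_le S1 S1' S2 (s t : R) :
  bounded S1 -> adjoint S1 S1' -> bounded S2 ->
  (I_loc (S1 \o S2) (s + t) <= (2 * c_nu)%:E *
    (I_loc S1 0 * I_loc S2 s + I_loc S1 t * I_loc S2 0))%E.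
Proof.
move=> b1 a1 b2; rewrite I_locE; last exact: bounded_operator_comp.
apply: ge_ereal_sup => _ [x _ <-].
apply: (le_trans (Jloc_comp_le s t x b1 a1 b2)).
rewrite lee_wpmul2l//; first by rewrite lee_fin mulr_ge0 ?(c_nu_ge0 _ _ hpos).
by apply: leeD; rewrite lee_wpmul2l ?I_loc_ge0// Jloc_le_I.
Qed.

End Localization.

(** * Finiteness and decay of functions of the radius *)

Section Decay.
Context {R : realType}.
Implicit Types f g u : R -> \bar R.
Local Open Scope ereal_scope.

(** The two conditions that [W_loc] imposes on [I_loc] of an operator, and again on that of its
    adjoint. *)
Definition decays f := f 0%R < +oo /\ f rho @[rho --> +oo%R] --> 0.

Lemma decays_lin (k : R) u f g : (0 <= k)%R -> (forall rho, 0 <= u rho) ->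
  (forall rho, u rho <= k%:E * f rho + g rho) ->
  decays f -> decays g -> decays u.
Proof.
move=> k0 u0 le [f0 lf] [g0 lg]; split.
  apply: le_lt_trans (le 0%R) _; apply: lte_add_pinfty g0.
  by apply: lte_mul_pinfty f0 => //; rewrite lee_fin.
apply: (@squeeze_cvge _ _ _ _ (cst 0) _ (fun rho => k%:E * f rho + g rho)).
- by near=> rho; rewrite u0 le.
- exact: cvg_cst.
- rewrite -[X in _ --> X](_ : k%:E * 0 + 0 = 0); last by rewrite mule0 adde0.
  by apply: cvgeD lg; [rewrite mule0|exact: cvgeZl].
Unshelve. all: by end_near. Qed.

(** With [s = t = rho / 2], each product has one factor tending to 0 and one fixed value at radius
    0. That value is finite, so the product tends to 0 in the extended reals. *)
Lemma decays_prod (k : R) u f g : (forall rho, 0 <= u rho) ->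
  (forall rho, 0 <= f rho) -> (forall rho, 0 <= g rho) ->
  (forall s t, u (s + t)%R <= k%:E * (f 0%R * g s + f t * g 0%R)) ->
  decays f -> decays g -> decays u.
Proof.
move=> u0 f0 g0 le [foo lf] [goo lg].
have ffin : f 0%R \is a fin_num by rewrite ge0_fin_numE.
have gfin : g 0%R \is a fin_num by rewrite ge0_fin_numE.
have half : (x / 2 : R)%R @[x --> +oo%R] --> +oo%R by apply: gt0_cvgMly.
split.
  have := le 0%R 0%R; rewrite addr0 => /le_lt_trans; apply.
  by rewrite ltey_eq fin_numM// fin_numD !fin_numM.
apply: (@squeeze_cvge _ _ _ _ (cst 0) _ (fun rho => k%:E *
  (f 0%R * g (rho / 2)%R + f (rho / 2)%R * g 0%R))).
- by near=> rho; rewrite u0 /=; have := le (rho / 2)%R (rho / 2)%R; rewrite -splitr.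
- exact: cvg_cst.
- rewrite -[X in _ --> X](_ : k%:E * (f 0%R * 0 + 0 * g 0%R) = 0); last first.
    by rewrite mule0 mul0e adde0 mule0.
  apply: cvgeZl => //; apply: cvgeD; first by rewrite mule0 mul0e.
    by apply: cvgeZl => //; exact: cvg_comp half lg.
  by apply: cvgeZr => //; exact: cvg_comp half lf.
Unshelve. all: by end_near. Qed.

End Decay.

(** The total mass is 1 unless [mu Omega] is 0 or [+oo]; in these two cases [fine] gives 0, whose
    inverse is 0 by convention, and the mass is 0. *)
Lemma normalized_lebesgue_finite (R : realType) n (Omega : set 'rV[R[i]]_n.+1)
    (vol : {measure set (borel 'rV[R[i]]_n.+1) -> \bar R}) :
  normalized_lebesgue Omega vol -> (vol setT < +oo)%E.
Proof.
move=> [mu _ ->]; last exact: measurableT.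
rewrite setTI; have := measure_ge0 mu Omega.
by case: (mu Omega) => [x| |]//= _; rewrite ?invr0 ?mule0 ?ltry.
Qed.

(** * Closure under linear combinations, products and adjoints *)

Section Algebra.
Context {R : realType} {n : nat}.
Local Notation C := R[i].
Local Notation T := 'rV[C]_n.+1.
Variables (Omega : set T) (vol : {measure set (borel T) -> \bar R}).
Variables (p : nat) (h : T -> T -> C) (nu : R) (K : T -> T -> C).
Variables (muG : {measure set (borelG Omega) -> \bar R}) (alpha : R).
Local Notation wt := (bergman_weight Omega vol h nu).
Hypothesis oO : open Omega.
Hypothesis O0 : Omega 0.
Hypothesis convexO : forall (t : R) z w, 0 <= t <= 1 -> Omega z -> Omega w ->
  Omega (t%:C *: z + (1 - t)%:C *: w).
Hypothesis vol_fin : (vol setT < +oo)%E.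
Hypothesis hpoly : sesqui_polynomial h.
Hypothesis hpos : forall z, Omega z -> 0 < h z z.
Hypothesis hK : weighted_kernel Omega vol p h nu K.
Hypothesis haar : normalized_haar vol p h muG.

Local Notation bounded := (bounded_operator Omega vol h nu).
Local Notation adjoint := (adjoint Omega vol h nu).
Local Notation I_loc := (I_loc vol p h nu K muG alpha).
Implicit Types S : (T -> C) -> T -> C.

Let wt_ge0 : forall z, Omega z -> 0 <= wt z :=
  @bergman_weight_ge0 _ _ _ vol _ nu hpos.
Let mwt : measurable_fun (Omega : set (borel T)) wt :=
  measurable_bergman_weight vol nu oO hpoly.
Let I0 S rho : bounded S -> (0 <= I_loc S rho)%E.
Proof. exact: I_loc_ge0. Qed.

Local Notation localized S := (decays (I_loc S)).

Lemma localized0 : localized (fun _ _ => 0).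
Proof.
have IE rho : I_loc (fun _ _ => 0) rho = 0%E by exact: I_loc0.
split; first by rewrite IE.
by rewrite (_ : (fun rho => _) = cst 0%E); [exact: cvg_cst|exact/funext].
Qed.

Lemma localized_lin (c : C) S1 S2 : bounded S1 -> bounded S2 ->
  localized S1 -> localized S2 -> localized (fun f z => c * S1 f z + S2 f z).
Proof.
move=> b1 b2; have b12 := bounded_operator_lin oO wt_ge0 mwt c b1 b2.
apply: decays_lin (normc_ge0 c) _ _ => rho; first exact: I0.
exact: I_loc_lin b1 b2.
Qed.

Lemma localized_comp S1 S1' S2 : bounded S1 -> adjoint S1 S1' -> bounded S2 ->
  localized S1 -> localized S2 -> localized (S1 \o S2).
Proof.
move=> b1 a1 b2; have b12 := bounded_operator_comp b1 b2.
apply: decays_prod => [rho|rho|rho|s t]; [exact: I0..|].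
exact: I_loc_comp_le a1 b2.
Qed.

Lemma W_locP S : W_loc vol p h nu K muG alpha S <->
  bounded S /\ exists S', [/\ adjoint S S', localized S & localized S'].
Proof.
split=> -[bS [S' []]].
  move=> a i1 i2 l1 l2; split; first exact: bS.
  by exists S'; split; [exact: a|exact: conj i1 l1|exact: conj i2 l2].
move=> a [i1 l1] [i2 l2]; split; first exact: bS.
by exists S'; split; [exact: a|exact: i1|exact: i2|exact: l1|exact: l2].
Qed.

Lemma W_loc_self_adjoint_subalgebra :
  self_adjoint_subalgebra Omega vol h nu (W_loc vol p h nu K muG alpha).
Proof.
split.
- by move=> S [].
- apply/W_locP; split; first exact: bounded_operator0.
  by exists (fun _ _ => 0); split; [exact: adjoint0|exact: localized0|exact: localized0].
- move=> c S1 S2 /W_locP[b1 [S1' [a1 l1 l1']]] /W_locP[b2 [S2' [a2 l2 l2']]].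
  have [b1' _] := a1; have [b2' _] := a2.
  apply/W_locP; split; first exact: bounded_operator_lin.
  exists (fun f z => c^* * S1' f z + S2' f z).
  by split; [exact: adjoint_lin|exact: localized_lin|exact: localized_lin].
- move=> S1 S2 /W_locP[b1 [S1' [a1 l1 l1']]] /W_locP[b2 [S2' [a2 l2 l2']]].
  have [b1' _] := a1; have [b2' _] := a2.
  (* The adjoint of [S1 \o S2] is [S2' \o S1']. Its estimate calls for an adjoint of the left factor
     [S2'], which is [S2]. *)
  have a2' := adjoint_sym oO wt_ge0 mwt b2 a2.
  apply/W_locP; split; first exact: bounded_operator_comp.
  exists (S2' \o S1'); split; first exact: adjoint_comp.
    exact: localized_comp a1 b2 l1 l2.
  exact: localized_comp a2' b1' l2' l1'.
(* The defining conditions are symmetric in an operator and its adjoint. *)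
- move=> S /W_locP[bS [S' [a l l']]]; exists S' => //.
  by apply/W_locP; split; [case: a|exists S; split => //; exact: adjoint_sym].
Qed.

End Algebra.

Theorem proposition4p5 (R : realType) (n : nat) (Omega : set 'rV[R[i]]_n.+1)
    (r a b : nat)
    (vol : {measure set (borel 'rV[R[i]]_n.+1) -> \bar R})
    (h : 'rV[R[i]]_n.+1 -> 'rV[R[i]]_n.+1 -> R[i])
    (muG : {measure set (borelG Omega) -> \bar R})
    (nu : R) (K : 'rV[R[i]]_n.+1 -> 'rV[R[i]]_n.+1 -> R[i]) :
  bounded_symmetric_domain Omega ->
  irreducible_domain Omega ->
  harish_chandra Omega ->
  of_type Omega r a b ->
  normalized_lebesgue Omega vol ->
  triple_determinant Omega vol (genus r a b) h ->
  normalized_haar vol (genus r a b) h muG ->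
  -1 + (r.-1 * a)%:R / 2 < nu ->
  weighted_kernel Omega vol (genus r a b) h nu K ->
  forall alpha : R,
    ((genus r a b)%:R - nu - 2) / 2 < alpha < (nu + b%:R + 2) / 2 ->
    self_adjoint_subalgebra Omega vol h nu
      (W_loc vol (genus r a b) h nu K muG alpha).
Proof.
move=> [[oO _ _] _ _] _ [ zeroO _ convexO] _ volE [hpoly _ _ hpos _] haar _ hK alpha _.
apply: W_loc_self_adjoint_subalgebra => //.
exact: normalized_lebesgue_finite volE.
Qed.
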